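(* Let $\beta>0$ and consider the contextual search problem in dimension $d$ with loss $\ell(\theta,p)=|\theta-p|^\beta$. Then SymmetricSearch (described in the context) achieves total loss $\sum_{t=1}^T|\langle u_t,v\rangle-p_t|^\beta\le C_{d,\beta}$, where $C_{d,\beta}$ depends only on $d$ and $\beta$ (not on $T$, $v$ or the adversary).
   Context: Contextual search problem in dimension $d$: an adversary fixes $v\in[0,1]^d$. In each round $t=1,\dots,T$ the adversary chooses a unit vector $u_t\in\mathbb{R}^d$, the learner chooses $p_t\in\mathbb{R}$, incurs loss $\ell(\langle u_t,v\rangle,p_t)$ and learns the sign of $\langle u_t,v\rangle-p_t$. Knowledge sets: $S_1=[0,1]^d$, $S_{t+1}=S_t^+(p_t;u_t):=\{x\in S_t:\langle u_t,x\rangle\ge p_t\}$ if $p_t\le\langle u_t,v\rangle$ was learned, else $S_{t+1}=S_t^-(p_t;u_t):=\{x\in S_t:\langle u_t,x\rangle\le p_t\}$. Intrinsic volumes: for compact convex $K\subset\mathbb{R}^d$ and unit ball $B$, $\mathrm{Vol}(K+\varepsilon B)=\sum_{j=0}^d\kappa_{d-j}V_j(K)\varepsilon^{d-j}$ ($\kappa_m$ = volume of the $m$-dimensional unit ball). Let $c_i=\frac{1}{2^{i-1}i!}$. SymmetricSearch in round $t$: let $w=\frac12\big(\max_{x\in S_t}\langle u_t,x\rangle-\min_{x\in S_t}\langle u_t,x\rangle\big)$. For $i=1,\dots,d$ choose $p_i$ with $V_i(S_t^+(p_i;u_t))=V_i(S_t^-(p_i;u_t))$, let $K_i=\{x\in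 S_t:\langle u_t,x\rangle=p_i\}$, $L_i=(V_i(K_i)/c_i)^{1/i}$; $L_0=\infty$. Choose $j$ with $L_{j-1}\ge w\ge L_j$ and guess $p_t=p_j$. *)

(* Defs.v *)
From HB Require Import structures.
From mathcomp Require Import all_boot all_order all_algebra.
From mathcomp Require Import all_classical all_reals all_analysis.

Set Implicit Arguments.
Unset Strict Implicit.
Unset Printing Implicit Defensive.

Import Order.TTheory GRing.Theory Num.Theory.
Import numFieldNormedType.Exports.

Local Open Scope classical_set_scope.
Local Open Scope ring_scope.

(* The norm that MathComp-Analysis puts on 'rV[R]_d is the sup norm, hence an
   explicit Euclidean structure. *)
Definition dot (R : realType) (d : nat) (x y : 'rV[R]_d) : R :=
  \sum_(i < d) x 0 i * y 0 i.

Definition enorm (R : realType) (d : nat) (x : 'rV[R]_d) : R :=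
  Num.sqrt (dot x x).

Definition unit_ball (R : realType) (d : nat) : set 'rV[R]_d :=
  [set x | enorm x <= 1].

Definition unit_cube (R : realType) (d : nat) : set 'rV[R]_d :=
  [set x | forall i, 0 <= x 0 i <= 1].

(* d-dimensional Lebesgue measure as the d-fold product of the library's
   lebesgue_measure on R: the successor case is the formula defining the
   product measure mu \x nu (integrate the measure of the section over the
   first coordinate), and 'rV[R]_0 is a single point of measure 1.  It is
   meant for Borel sets and is only ever applied below to compact sets. *)
Fixpoint vol (R : realType) (d : nat) : set 'rV[R]_d -> \bar R :=
  match d return set 'rV[R]_d -> \bar R with
  | 0%N => fun A => (\1_A 0)%:E
  | d'.+1 => fun A => (\int[@lebesgue_measure R]_x
      vol [set y : 'rV[R]_d' | A (row_mx (x%:M : 'rV[R]_1) y)])%E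
  end.

Definition ball_volume (R : realType) (m : nat) : R :=
  fine (vol (@unit_ball R m)).

Definition parallel_body (R : realType) (d : nat) (K : set 'rV[R]_d) (eps : R)
    : set 'rV[R]_d :=
  [set z | exists x b, [/\ K x, unit_ball b & z = x + eps *: b]].

(* V_0(K), V_1(K), ..., V_d(K), extended by 0 beyond index d.  The Steiner
   formula on the right determines V_0, ..., V_d, since it fixes all the
   coefficients of a polynomial in eps and every ball volume is nonzero; hence
   get selects the unique such sequence when K is compact and convex.  In
   particular all the intrinsic volumes of the empty set are 0. *)
Definition intrinsic_volumes (R : realType) (d : nat) (K : set 'rV[R]_d)
    : nat -> R :=
  get [set V : nat -> R |
    (forall j, (d < j)%N -> V j = 0) /\
    forall eps : R, 0 <= eps ->
      vol (parallel_body K eps) =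
      (\sum_(j < d.+1) ball_volume R (d - j) * V j * eps ^+ (d - j))%:E].

Definition intrinsic_volume (R : realType) (d : nat) (j : nat)
    (K : set 'rV[R]_d) : R := intrinsic_volumes K j.

Definition upper_part (R : realType) (d : nat) (S : set 'rV[R]_d)
    (p : R) (u : 'rV[R]_d) : set 'rV[R]_d := [set x | S x /\ dot u x >= p].

Definition lower_part (R : realType) (d : nat) (S : set 'rV[R]_d)
    (p : R) (u : 'rV[R]_d) : set 'rV[R]_d := [set x | S x /\ dot u x <= p].

Definition section (R : realType) (d : nat) (S : set 'rV[R]_d)
    (p : R) (u : 'rV[R]_d) : set 'rV[R]_d := [set x | S x /\ dot u x = p].

(* Rounds are numbered from 0, so knowledge u p v 0 is the set before the
   first round. *)
Fixpoint knowledge (R : realType) (d : nat) (u : nat -> 'rV[R]_d)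
    (p : nat -> R) (v : 'rV[R]_d) (t : nat) : set 'rV[R]_d :=
  if t is t'.+1 then
    if p t' <= dot (u t') v
    then upper_part (knowledge u p v t') (p t') (u t')
    else lower_part (knowledge u p v t') (p t') (u t')
  else @unit_cube R d.

(* The sup and inf are attained, the knowledge sets being compact and
   nonempty. *)
Definition half_width (R : realType) (d : nat) (S : set 'rV[R]_d)
    (u : 'rV[R]_d) : R :=
  (sup [set dot u x | x in S] - inf [set dot u x | x in S]) / 2.

Definition c_ (R : realType) (i : nat) : R := (2 ^+ i.-1 * i`!%:R)^-1.

(* q i is the balanced cut p_i; q 0 is irrelevant. *)
Definition L_ (R : realType) (d : nat) (S : set 'rV[R]_d) (u : 'rV[R]_d)
    (q : nat -> R) (i : nat) : \bar R :=
  if i is 0%N then +oo%E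
  else ((intrinsic_volume i (section S (q i) u) / c_ R i) `^ (i%:R^-1))%:E.

(* p is a guess that the algorithm may make on the knowledge set S and the
   direction u. *)
Definition symmetric_search_guess (R : realType) (d : nat) (S : set 'rV[R]_d)
    (u : 'rV[R]_d) (p : R) : Prop :=
  exists (q : nat -> R) (j : nat),
    [/\ forall i, (1 <= i <= d)%N ->
          intrinsic_volume i (upper_part S (q i) u) =
          intrinsic_volume i (lower_part S (q i) u),
        (1 <= j <= d)%N,
        ((half_width S u)%:E <= L_ S u q j.-1)%E,
        (L_ S u q j <= (half_width S u)%:E)%E
      & p = q j].

Definition symmetric_search (R : realType) (d : nat) (T : nat)
    (u : nat -> 'rV[R]_d) (v : 'rV[R]_d) (p : nat -> R) : Prop :=
  forall t, (t < T)%N -> symmetric_search_guess (knowledge u p v t) (u t) (p t).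

Definition loss (R : realType) (beta theta p : R) : R :=
  `|theta - p| `^ beta.

(* Main.v *)
Require Import Defs.
From HB Require Import structures.
From mathcomp Require Import all_boot all_order all_algebra.
From mathcomp Require Import all_classical all_reals all_analysis.
From mathcomp Require Import measurable_realfun qpoly ring lra.

(* Write V_j for the j-th intrinsic volume, w for the half width of the
   knowledge set S and K_i for its section by the i-th balanced cut.  If j is
   the chosen index, then V_(j-1)(K_(j-1)) >= c_(j-1) w^(j-1), and S contains
   a cone over K_(j-1) of height h >= w.  The cone inequality
   V_j(S) >= (h / j) V_(j-1)(K_(j-1)) gives V_j(S) >= 2 c_j w^j >= 2 V_j(K_j),
   so that, V_j being a valuation, both sides of the j-th cut have at most 3/4
   of V_j(S).  As the loss is at most (2 w)^beta, hence at most a constant times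
   V_j(S)^(beta / j), a weighted sum over all j of V_j(S)^(beta / j) decreases
   in each round by at least the loss.  The cut never misses the interior of S,
   because V_j(S) > 0 throughout.

   Adding a segment to a convex body adds to its volume the length of the
   segment times the volume of the projection along it.  Hence, for a zonotope
   Z, the volume of K + eps Z is a polynomial in eps whose coefficients are
   nonnegative and monotone in K.  The unit ball is a limit of zonotopes, so
   the Steiner formula and the monotonicity of V_j follow by passing to the
   limit.

   The cone inequality comes from cutting a cone near its base: the upper part
   is a smaller copy of the cone, the lower part contains an oblique cylinder,
   and an oblique cylinder has at least the V_j of the right one. *)

Set Implicit Arguments.
Unset Strict Implicit.
Unset Printing Implicit Defensive.

Import Order.TTheory GRing.Theory Num.Theory.
Import numFieldNormedType.Exports.

Local Open Scope classical_set_scope.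
Local Open Scope ring_scope.

(** * Lebesgue measure on row vectors *)

(** As [intrinsic_volumes] is a [get], nothing is known about V_j until every convex body has a
    Steiner polynomial; after that each fact about V_j is obtained by comparing coefficients of
    parallel volumes. Zonotopes reduce the existence of this polynomial to Fubini along one
    direction at a time. The constants satisfy c_(j-1) = 2 j c_j for j >= 2, so the factor 1/j of
    the cone inequality turns c_(j-1) into exactly 2 c_j. This 2 makes V_j(K_j) at most half of
    V_j(S), and a balanced side, being (V_j(S) + V_j(K_j)) / 2, at most 3/4 of V_j(S). For j = 1 the
    condition on L_0 = +oo says nothing, and V_1(S) >= 2 w is used instead. The chosen index may
    change from round to round, which is why the potential sums over all of them: the terms that are
    not chosen must at least not grow, and this requires the monotonicity of every V_j, not just of
    the volume. *)

Lemma image_measure (d1 d2 : measure_display) (T1 : measurableType d1) (T2 : measurableType d2)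
    (R : realType) (m : {measure set T1 -> \bar R}) (f : T1 -> T2) :
  measurable_fun setT f ->
  exists m' : {measure set T2 -> \bar R}, forall A, m' A = m (f @^-1` A).
Proof.
move=> mf.
have mpre (A : set T2) : measurable A -> measurable (f @^-1` A).
  by move=> mA; rewrite -[X in measurable X]setTI; exact: mf.
pose nu (A : set T2) := m (f @^-1` A).
have nu0 : nu set0 = 0%E by rewrite /nu preimage_set0 measure0.
have nu_ge0 A : (0 <= nu A)%E by exact: measure_ge0.
have nuS : semi_sigma_additive nu.
  move=> F mF tF mUF; rewrite /nu preimage_bigcup.
  apply: measure_semi_sigma_additive.
  - by move=> n; exact: mpre.
  - apply/trivIsetP => /= i j _ _ ij; rewrite -preimage_setI.
    by move/trivIsetP : tF => /(_ _ _ _ _ ij) ->//; rewrite preimage_set0.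
  - by rewrite -preimage_bigcup; exact: mpre.
pose mnu : {measure set T2 -> \bar R} :=
  HB.pack nu (isMeasure.Build _ _ _ nu nu0 nu_ge0 nuS).
by exists mnu.
Qed.

Lemma sigma_finite_pack (disp : measure_display) (T : measurableType disp)
    (R : realType) (m : {measure set T -> \bar R}) :
  sigma_finite setT m ->
  exists m' : {sigma_finite_measure set T -> \bar R}, forall A, m' A = m A.
Proof.
move=> sf.
pose nu (A : set T) := m A.
have nu0 : nu set0 = 0%E by exact: measure0.
have nu_ge0 A : (0 <= nu A)%E by exact: measure_ge0.
have nuS : semi_sigma_additive nu by exact: measure_semi_sigma_additive.
pose b := isMeasure.Build _ _ _ nu nu0 nu_ge0 nuS.
pose mnu : {measure set T -> \bar R} := HB.pack nu b.
pose b' := Measure_isSigmaFinite.Build _ _ _ mnu sf.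
pose snu : {sigma_finite_measure set T -> \bar R} := HB.pack nu b b'.
by exists snu.
Qed.

Definition coordinate_sets (R : realType) (d : nat) : set (set 'rV[R]_d) :=
  [set A | exists i (B : set R), measurable B /\ A = [set y : 'rV[R]_d | B (y 0 i)]].

(* 'rV[R]_d with its Borel sets, presented as generated by the coordinates, so
   that a map into it is measurable as soon as its coordinates are. *)
Notation mrV R d := (g_sigma_algebraType (@coordinate_sets R d)).

Lemma measurable_coord (R : realType) (d : nat) (i : 'I_d) :
  measurable_fun [set: mrV R d] (fun y : mrV R d => (y : 'rV[R]_d) 0 i).
Proof.
move=> _ B mB; rewrite setTI; apply: sub_sigma_algebra.
by exists i, B.
Qed.

Lemma measurable_funrV (disp : measure_display) (T : measurableType disp)
    (R : realType) (d : nat) (f : T -> 'rV[R]_d) :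
  (forall i, measurable_fun setT (fun t => f t 0 i)) ->
  measurable_fun setT (f : T -> mrV R d).
Proof.
move=> mf; apply: (@measurability _ _ _ (mrV R d) _ _ (@coordinate_sets R d)) => //.
move=> _ [_ [i [B [mB ->]]] <-].
by have := mf i measurableT B mB.
Qed.

Lemma measurable_rV_ball (R : realType) (d : nat) (c : 'rV[R]_d) (e : R) :
  measurable (ball c e : set (mrV R d)).
Proof.
have [e0|e0] := ltP 0 e; last first.
  rewrite (_ : ball c e = set0) //; apply/seteqP; split => // y [].
  by rewrite ltNge e0.
rewrite (_ : ball c e = \bigcap_(i in [set: 'I_d])
    [set y : mrV R d | ball (c 0 i) e ((y : 'rV[R]_d) 0 i)]).
  apply: fin_bigcap_measurable => [|i _]; first exact: finite_finset.
  have := @measurable_coord R d i measurableT (ball (c 0 i) e).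
  rewrite setTI.
  by apply; apply: open_measurable; exact: ball_open.
apply/seteqP; split => [y [_ yc] i _ /=|y yc]; first exact: yc.
by split => // i j; rewrite ord1; exact: yc.
Qed.

Lemma rat_approx (R : realType) (x e : R) : 0 < e ->
  exists q : rat, `|x - ratr q| < e.
Proof.
move=> e0; have /rat_in_itvoo[q /itvP qx] : x - e < x + e by lra.
by exists q; rewrite distrC ltr_distl !qx.
Qed.

Lemma measurable_rV_open (R : realType) (d : nat) (A : set 'rV[R]_d) :
  open A -> measurable (A : set (mrV R d)).
Proof.
move=> oA.
pose P (q : 'rV[rat]_d * rat) := (ball (map_mx ratr q.1 : 'rV[R]_d) (ratr q.2 : R)).
rewrite (_ : A = \bigcup_(q in [set q | P q `<=` A]) P q).
  rewrite bigcup_mkcond; apply: countable_bigcupT_measurable => // q.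
  by case: ifP => // _; exact: measurable_rV_ball.
apply/seteqP; split => [y Ay|y [q qA yq]]; last exact: qA.
move: oA; rewrite openE => /(_ _ Ay)/nbhs_ballP[e /= e0 eA].
have e30 : 0 < e / 3 by rewrite divr_gt0.
(* A radius strictly between [e / 3] and [2 e / 3], with a rational centre within [e / 3] of y in
   each coordinate: the ball contains y and stays within e of it. *)
have [r r_e] := rat_approx (e / 2) (divr_gt0 e0 (ltr0n _ 8)).
have r0 : e / 3 < ratr r by move: r_e; rewrite ltr_norml; lra.
have r1 : ratr r < e * 2 / 3 by move: r_e; rewrite ltr_norml; lra.
have /choice[q qy] : forall i : 'I_d, exists q : rat, `|y 0 i - ratr q| < e / 3.
  by move=> i; exact: rat_approx.
exists (\row_i q i, r) => /=; last first.
  split => /=; first by rewrite (lt_trans e30).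
  move=> i j; rewrite ord1 !mxE /ball /= distrC; exact: lt_trans (qy j) r0.
move=> z [_ /= zq]; apply: eA; split => // i j; rewrite ord1.
have := zq 0 j; have := qy j; rewrite !mxE /ball /= => h1 h2.
have -> : y 0 j - z 0 j = (y 0 j - ratr (q j)) + (ratr (q j) - z 0 j) by ring.
by rewrite (le_lt_trans (ler_normD _ _))//; lra.
Qed.

Lemma measurable_rV_closed (R : realType) (d : nat) (A : set 'rV[R]_d) :
  closed A -> measurable (A : set (mrV R d)).
Proof.
move=> cA; rewrite -(setCK A); apply: measurableC.
by apply: measurable_rV_open; rewrite openC.
Qed.

Definition consrV (R : realType) (d : nat) (xy : R * 'rV[R]_d) : 'rV[R]_d.+1 :=
  row_mx (xy.1%:M : 'rV[R]_1) xy.2.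

Lemma consrV0 (R : realType) (d : nat) (x : R) (y : 'rV[R]_d) :
  consrV (x, y) 0 ord0 = x.
Proof.
have -> : ord0 = lshift d (0 : 'I_1) by apply: val_inj.
by rewrite /consrV (@row_mxEl R 1 1 d) /= mxE eqxx.
Qed.

Lemma consrVS (R : realType) (d : nat) (x : R) (y : 'rV[R]_d) i :
  consrV (x, y) 0 (lift ord0 i) = y 0 i.
Proof.
have -> : lift ord0 i = rshift 1 i by apply: val_inj.
by rewrite /consrV (@row_mxEr R 1 1 d).
Qed.

Lemma measurable_consrV (R : realType) (d : nat) :
  measurable_fun [set: measurableTypeR R * mrV R d] (@consrV R d : _ -> mrV R d.+1).
Proof.
apply: measurable_funrV => i; have [j ->|->] := unliftP ord0 i.
  rewrite (_ : (fun t => _) = (fun y : mrV R d => (y : 'rV[R]_d) 0 j) \o snd).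
    by apply: measurableT_comp => //; exact: measurable_coord.
  by apply/funext => -[x y] /=; rewrite consrVS.
rewrite (_ : (fun t => _) = fst) //.
by apply/funext => -[x y] /=; rewrite consrV0.
Qed.

Lemma consrVK (R : realType) (d : nat) (z : 'rV[R]_d.+1) :
  consrV (z 0 0, \row_i z 0 (lift ord0 i)) = z.
Proof.
apply/rowP => i; have [j ->|->] := unliftP ord0 i.
  by rewrite consrVS mxE.
by rewrite consrV0.
Qed.

Lemma vol_succ (R : realType) (d : nat) (A : set 'rV[R]_d.+1) :
  vol A = (\int[@lebesgue_measure R]_x vol [set y | A (consrV (x, y))])%E.
Proof. by []. Qed.

(** In the successor case the product of Lebesgue measure with the measure given by induction is
    carried to row vectors by [consrV]. Its value is the very integral that defines [vol], so the
    equality holds for all sets. Sigma-finiteness is part of the induction because Fubini's theorem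
    needs it. *)
Lemma vol_measure (R : realType) (d : nat) :
  exists mu : {sigma_finite_measure set (mrV R d) -> \bar R},
    forall A : set 'rV[R]_d, vol A = mu A.
Proof.
elim: d => [|d [mu vol_mu]].
  exists (@dirac _ (mrV R 0) (0 : 'rV[R]_0) R) => A.
  by rewrite /= diracE indicE.
have [nu nuE] := @image_measure _ _ _ _ _ (@lebesgue_measure R \x mu)%E _
  (@measurable_consrV R d).
have vol_nu A : vol A = nu A.
  rewrite vol_succ nuE; transitivity (\int[@lebesgue_measure R]_x
    (mu \o xsection (@consrV R d @^-1` A)) x)%E => //.
  apply: eq_integral => x _ /=; rewrite vol_mu; congr (mu _).
  by apply/seteqP; split => y; rewrite /xsection /= inE.
have sf : sigma_finite setT nu.
  have /sigma_finiteP[F [TF ndF Fm]] := sigma_finiteT (@lebesgue_measure R).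
  have /sigma_finiteP[G [TG ndG Gm]] := sigma_finiteT mu.
  have cV : cancel (fun z : 'rV[R]_d.+1 => (z 0 0, \row_i z 0 (lift ord0 i)))
    (@consrV R d) by move=> z; exact: consrVK.
  have cVK : cancel (@consrV R d)
      (fun z : 'rV[R]_d.+1 => (z 0 0, \row_i z 0 (lift ord0 i))).
    move=> [x y]; rewrite consrV0; congr pair.
    by apply/rowP => i; rewrite mxE consrVS.
  have mV : measurable_fun [set: mrV R d.+1]
      ((fun z : 'rV[R]_d.+1 => (z 0 0, \row_i z 0 (lift ord0 i)))
       : mrV R d.+1 -> measurableTypeR R * mrV R d).
    apply: measurable_fun_pair; first exact: measurable_coord.
    apply: measurable_funrV => i.
    under eq_fun do rewrite mxE.
    exact: measurable_coord.
  exists (fun n => (fun z : 'rV[R]_d.+1 => (z 0 0, \row_i z 0 (lift ord0 i)))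
    @^-1` (F n `*` G n)).
    rewrite -preimage_bigcup; apply/seteqP; split => // z _.
    have [n _ Fz] : (\bigcup_i F i) (z 0 0) by rewrite -TF.
    have [k _ Gz] : (\bigcup_i G i) (\row_i z 0 (lift ord0 i)) by rewrite -TG.
    exists (maxn n k) => //; split => /=.
      by move: Fz; exact/subsetPset/ndF/leq_maxl.
    by move: Gz; exact/subsetPset/ndG/leq_maxr.
  move=> n; have [mF Foo] := Fm n; have [mG Goo] := Gm n; split.
    by rewrite -[X in measurable X]setTI; apply: mV => //; exact: measurableX.
  rewrite nuE -comp_preimage.
  rewrite (_ : _ @^-1` _ = F n `*` G n); last first.
    apply/funext => z; rewrite /preimage /mkset.
    by congr ((F n `*` G n) _); exact: cVK.
  have FG := product_measure1E (@lebesgue_measure R) mu mF mG.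
  apply: (le_lt_trans (y := (@lebesgue_measure R (F n) * mu (G n))%E)).
    by move: FG => /eqP; rewrite eq_le => /andP[].
  by rewrite lte_mul_pinfty// ge0_fin_numE.
have [snu snuE] := sigma_finite_pack sf.
by exists snu => A; rewrite vol_nu snuE.
Qed.

Lemma measurable_translation (R : realType) (c : R) :
  measurable_fun [set: measurableTypeR R] ((+%R c) : _ -> measurableTypeR R).
Proof.
exact: measurable_funD.
Qed.

(** The image of Lebesgue measure under the translation gives half-open intervals their length,
    which characterises Lebesgue measure. *)
Lemma lebesgue_measure_translation (R : realType) (c : R) (A : set (measurableTypeR R)) :
  measurable A ->
  @lebesgue_measure R (+%R c @^-1` A) = @lebesgue_measure R A.
Proof.
move=> mA; apply/esym.
have [m mE] := image_measure (@lebesgue_measure R) (measurable_translation c).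
rewrite -mE; apply: lebesgue_measure_unique => //.
move=> _ [[a b] _ <-]; rewrite [RHS]mE.
rewrite (_ : _ @^-1` _ = `]a - c, b - c]%classic).
  rewrite lebesgue_measure_itv [RHS]lebesgue_measure_itv /= !lte_fin (ltrD2r (- c)).
  by case: ifP => // _; rewrite -!EFinD; congr (_%:E); ring.
apply/seteqP; split => x /=; rewrite !in_itv /=; lra.
Qed.


Lemma ge0_integral_translation (R : realType) (c : R) (f : measurableTypeR R -> \bar R) :
  measurable_fun setT f -> (forall x, 0 <= f x)%E ->
  (\int[@lebesgue_measure R]_x f (c + x)%R = \int[@lebesgue_measure R]_x f x)%E.
Proof.
move=> mf f0.
pose g : measurableTypeR R -> measurableTypeR R := +%R c.
have mg : measurable_fun setT g := measurable_translation c.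
have := ge0_integral_pushforward mg (@lebesgue_measure R) measurableT mf
  (fun x _ => f0 x).
rewrite preimage_setT => <-.
have [m mE] := image_measure (@lebesgue_measure R) mg.
transitivity (\int[m]_x f x)%E; first by congr (integral _ _ _); apply/funext => A; rewrite mE.
apply: eq_measure_integral => A mA _.
by rewrite mE; exact: lebesgue_measure_translation.
Qed.

Lemma measurable_preim (d1 d2 : measure_display) (T1 : measurableType d1)
    (T2 : measurableType d2) (f : T1 -> T2) (A : set T2) :
  measurable_fun setT f -> measurable A -> measurable [set x | A (f x)].
Proof. by move=> mf mA; rewrite -[X in measurable X]setTI; exact: mf. Qed.

(** By induction on the dimension: the outer integral absorbs the first coordinate of c and the
    sections absorb the others. *)
Lemma vol_translation (R : realType) (d : nat) (c : 'rV[R]_d) (A : set 'rV[R]_d) :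
  measurable (A : set (mrV R d)) -> vol [set x | A (c + x)] = vol A.
Proof.
elim: d c A => [|d ih] c A mA.
  by congr (vol _); apply/funext => x; congr (A _); apply/rowP => -[].
rewrite !vol_succ.
pose c' := \row_i c 0 (lift ord0 i).
have [mu vol_mu] := vol_measure R d.
have mA' : measurable (@consrV R d @^-1` A : set (measurableTypeR R * mrV R d)).
  by rewrite -[X in measurable X]setTI; exact: measurable_consrV.
rewrite -[RHS](@ge0_integral_translation _ (c 0 0)); last 2 first.
- under eq_fun do rewrite vol_mu.
  have := measurable_fun_xsection mu mA'.
  congr (measurable_fun _ _); apply/funext => x /=; congr (mu _).
  by apply/seteqP; split => y; rewrite /xsection /= inE.
- by move=> x; rewrite vol_mu; exact: measure_ge0.
apply: eq_integral => x _; rewrite -[RHS](ih c').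
  congr (vol _); apply/funext => y /=; congr (A _); apply/rowP => i.
  have [j ->|->] := unliftP ord0 i; rewrite [LHS]mxE.
    by rewrite !consrVS !mxE.
  by rewrite !consrV0.
apply: (@measurable_preim _ _ (mrV R d) (mrV R d.+1)
  (fun y => consrV (c 0 0 + x, y))) => //.
apply: (measurableT_comp (@measurable_consrV R d)).
exact: measurable_fun_pair.
Qed.

Lemma integral_section_swap (d1 d2 : measure_display) (T1 : measurableType d1)
    (T2 : measurableType d2) (R : realType)
    (m1 : {sigma_finite_measure set T1 -> \bar R})
    (m2 : {sigma_finite_measure set T2 -> \bar R}) (A : set (T1 * T2)) :
  measurable A ->
  (\int[m1]_x m2 [set y | A (x, y)] = \int[m2]_y m1 [set x | A (x, y)])%E.
Proof.
move=> mA.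
have := indic_fubini_tonelli m1 m2 mA.
move=> FG; transitivity (\int[m1]_x fubini_F m2 (EFin \o \1_A) x)%E.
  apply: eq_integral => x _.
  have -> : fubini_F m2 (EFin \o \1_A) = m2 \o xsection A.
    exact: indic_fubini_tonelli_FE.
  congr (m2 _).
  by apply/seteqP; split => y; rewrite /xsection /= inE.
rewrite FG; apply: eq_integral => y _.
have -> : fubini_G m1 (EFin \o \1_A) = m1 \o ysection A.
  exact: indic_fubini_tonelli_GE.
congr (m1 _).
by apply/seteqP; split => x; rewrite /ysection /= inE.
Qed.

Lemma measurable_mulmx (R : realType) (m n : nat) (M : 'M[R]_(m, n)) :
  measurable_fun [set: mrV R m] ((fun x : 'rV[R]_m => x *m M) : _ -> mrV R n).
Proof.
apply: measurable_funrV => i; under eq_fun do rewrite mxE.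
apply: measurable_sum => j; apply: measurable_funM => //.
exact: measurable_coord.
Qed.

Lemma measurable_rV_linear2 (disp : measure_display) (T : measurableType disp)
    (R : realType) (d : nat) (a b : R) (f g : T -> mrV R d) :
  measurable_fun setT f -> measurable_fun setT g ->
  measurable_fun setT ((fun t => a *: (f t : 'rV[R]_d) + b *: (g t : 'rV[R]_d))
    : _ -> mrV R d).
Proof.
move=> mf mg; apply: measurable_funrV => i; under eq_fun do rewrite !mxE.
by apply: measurable_funD; apply: measurable_funM => //;
  apply: (measurableT_comp (@measurable_coord R d i)).
Qed.

Lemma vol_ge0 (R : realType) (d : nat) (A : set 'rV[R]_d) : (0 <= vol A)%E.
Proof. by have [mu ->] := vol_measure R d; exact: measure_ge0. Qed.

Lemma le_vol (R : realType) (d : nat) (A B : set 'rV[R]_d) :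
  measurable (A : set (mrV R d)) -> measurable (B : set (mrV R d)) ->
  A `<=` B -> (vol A <= vol B)%E.
Proof.
move=> mA mB AB; have [mu vol_mu] := vol_measure R d.
by rewrite !vol_mu le_measure ?inE.
Qed.

Lemma vol_modular (R : realType) (d : nat) (A B : set 'rV[R]_d) :
  measurable (A : set (mrV R d)) -> measurable (B : set (mrV R d)) ->
  (vol A < +oo -> vol (A `|` B) + vol (A `&` B) = vol A + vol B)%E.
Proof.
move=> mA mB; have [mu vol_mu] := vol_measure R d.
rewrite !vol_mu => Aoo; rewrite measureUfinl // subeK //.
rewrite ge0_fin_numE //; apply: le_lt_trans Aoo.
by rewrite le_measure ?inE //; exact: measurableI.
Qed.

(* Both sides are the measure of {(x, y) | x \in A, y *m M + x \in E} in the
   square of the space, up to a translation of one of the two variables. *)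
Lemma vol_mulmx_swap (R : realType) (d : nat) (M N : 'M[R]_d)
    (A E : set 'rV[R]_d) : N *m M = 1%:M ->
  measurable (A : set (mrV R d)) -> measurable (E : set (mrV R d)) ->
  (vol A * vol [set x | E (x *m M)] = vol E * vol [set x | A (- (x *m M))%R])%E.
Proof.
move=> NM mA mE; have [mu vol_mu] := vol_measure R d.
have mM := measurable_mulmx M.
have mpre (D : set (mrV R d)) (a : R) : measurable D ->
    measurable [set xy : mrV R d * mrV R d |
      D ((xy.1 : 'rV[R]_d) + a *: ((xy.2 : 'rV[R]_d) *m M))].
  move=> mD; apply: (measurable_preim (f := fun xy : mrV R d * mrV R d =>
    ((xy.1 : 'rV[R]_d) + a *: ((xy.2 : 'rV[R]_d) *m M)) : mrV R d)) => //.
  rewrite (_ : (fun _ => _) = (fun xy : mrV R d * mrV R d =>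
      1 *: (xy.1 : 'rV[R]_d) + a *: ((xy.2 : 'rV[R]_d) *m M))); last first.
    by apply/funext => xy; rewrite scale1r.
  apply: measurable_rV_linear2 => //.
  exact: (measurableT_comp mM measurable_snd).
have mfst (D : set (mrV R d)) : measurable D ->
    measurable [set xy : mrV R d * mrV R d | D xy.1].
  exact: measurable_preim.
have mcst (D : set 'rV[R]_d) : measurable (D : set (mrV R d)) -> forall c,
    measurable ([set x | D (c + x)] : set (mrV R d)).
  move=> mD c.
  apply: (measurable_preim (f := (fun x => c + x) : mrV R d -> mrV R d)) => //.
  apply: measurable_funrV => i; under eq_fun do rewrite mxE.
  by apply: measurable_funD => //; exact: measurable_coord.
have mh (D : set 'rV[R]_d) : measurable (D : set (mrV R d)) ->
    measurable ([set x | D (x *m M)] : set (mrV R d)).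
  exact: measurable_preim.
have mhN (D : set 'rV[R]_d) : measurable (D : set (mrV R d)) ->
    measurable ([set x | D (- (x *m M))] : set (mrV R d)).
  move=> mD; rewrite (_ : [set _ | _] = [set x | D (x *m - M)]).
    by apply: (measurable_preim (measurable_mulmx _)).
  by apply/seteqP; split => x /=; rewrite mulmxN.
pose P := [set xy : mrV R d * mrV R d | A xy.1] `&`
  [set xy : mrV R d * mrV R d |
     E ((xy.1 : 'rV[R]_d) + 1 *: ((xy.2 : 'rV[R]_d) *m M))].
pose Q := [set xy : mrV R d * mrV R d | E xy.1] `&`
  [set xy : mrV R d * mrV R d |
     A ((xy.1 : 'rV[R]_d) + (- 1) *: ((xy.2 : 'rV[R]_d) *m M))].
have mP : measurable P by apply: measurableI; [exact: mfst|exact: mpre].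
have mQ : measurable Q by apply: measurableI; [exact: mfst|exact: mpre].
have intc (D : set (mrV R d)) (c : \bar R) : measurable D ->
    (\int[mu]_x (if x \in D then c else 0) = mu D * c)%E.
  move=> mD; rewrite -integral_mkcond /= integral_cst //.
  by rewrite muleC.
transitivity (\int[mu]_x mu [set y | P (x, y)])%E.
  rewrite !vol_mu -intc //; apply: eq_integral => x _; case: ifPn => xA.
    rewrite -!vol_mu -(vol_translation (x *m N)); last exact: mh.
    congr (vol _); apply/seteqP; split => y; rewrite /P /=.
      by rewrite mulmxDl -mulmxA NM mulmx1 scale1r; rewrite inE in xA.
    by rewrite mulmxDl -mulmxA NM mulmx1 scale1r => -[].
  rewrite (_ : [set _ | _] = set0) ?measure0 //.
  by apply/seteqP; split => y //= -[/= Ax]; rewrite notin_setE in xA.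
rewrite integral_section_swap //.
transitivity (\int[mu]_y mu [set x | Q (x, y)])%E.
  apply: eq_integral => y _; rewrite -!vol_mu -[RHS](vol_translation (y *m M)).
    congr (vol _); apply/seteqP; split => x /=.
      by rewrite /P /Q /= !scale1r !scaleN1r ![y *m M + x]addrC addrK; tauto.
    by rewrite /P /Q /= !scale1r !scaleN1r ![y *m M + x]addrC addrK; tauto.
  have := measurable_ysection y mQ.
  by congr measurable; apply/seteqP; split => x; rewrite /ysection /= inE.
rewrite -integral_section_swap // !vol_mu -intc //.
apply: eq_integral => x _; case: ifPn => xE; last first.
  rewrite (_ : [set _ | _] = set0) ?measure0 //.
  by apply/seteqP; split => y //= -[/= Ax]; rewrite notin_setE in xE.
rewrite -!vol_mu -[RHS](vol_translation (- (x *m N))); last exact: mhN.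
congr (vol _); apply/seteqP; split => y; rewrite /Q /=.
  by move=> [_] /=; rewrite mulmxDl mulNmx -mulmxA NM mulmx1 opprD opprK scaleN1r.
rewrite mulmxDl mulNmx -mulmxA NM mulmx1 opprD opprK => h.
by split; [rewrite inE in xE|rewrite /= scaleN1r].
Qed.

(** * Euclidean geometry and convex bodies *)

Lemma rV_continuous (T : topologicalType) (R : realType) (d : nat)
    (f : T -> 'rV[R]_d) :
  (forall i, continuous (fun x => f x 0 i)) -> continuous f.
Proof.
move=> cf x; apply/cvg_ballP => e e0.
have : \forall y \near x, forall i, ball (f x 0 i) e (f y 0 i).
  apply: filter_forall => i.
  by have /cvg_ballP/(_ _ e0) := cf i x.
apply: filterS => y fy; split => // i j; rewrite ord1; exact: fy.
Qed.

Lemma coord_rV_continuous (R : realType) (d : nat) (i : 'I_d) :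
  continuous (fun x : 'rV[R]_d => x 0 i).
Proof. exact: coord_continuous. Qed.

Lemma sum_continuous_fun (T : topologicalType) (R : realType) (I : finType)
    (f : I -> T -> R) :
  (forall i, continuous (f i)) -> continuous (fun x => \sum_i f i x).
Proof.
move=> cf; rewrite (_ : (fun x => _) = \sum_i f i); last first.
  by apply/funext => x; rewrite fct_sumE.
apply: (big_ind (fun g : T -> R => continuous g)) => [x|g h cg ch x|i _].
- exact: cvg_cst.
- exact: (cvgD (cg x) (ch x)).
- exact: cf.
Qed.

Lemma mulmx_continuous (R : realType) (m n : nat) (M : 'M[R]_(m, n)) :
  continuous (fun x : 'rV[R]_m => x *m M).
Proof.
apply: rV_continuous => i; under eq_fun do rewrite mxE.
apply: sum_continuous_fun => j x; apply: continuousM; last exact: cst_continuous.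
exact: coord_rV_continuous.
Qed.

Lemma dotC (R : realType) (d : nat) (x y : 'rV[R]_d) : dot x y = dot y x.
Proof. by apply: eq_bigr => i _; rewrite mulrC. Qed.

Lemma dotDr (R : realType) (d : nat) (x y z : 'rV[R]_d) :
  dot x (y + z) = dot x y + dot x z.
Proof. by rewrite -big_split; apply: eq_bigr => i _; rewrite mxE mulrDr. Qed.

Lemma dotZr (R : realType) (d : nat) (a : R) (x y : 'rV[R]_d) :
  dot x (a *: y) = a * dot x y.
Proof. by rewrite mulr_sumr; apply: eq_bigr => i _; rewrite mxE mulrCA. Qed.

Lemma dotDl (R : realType) (d : nat) (x y z : 'rV[R]_d) :
  dot (y + z) x = dot y x + dot z x.
Proof. by rewrite dotC dotDr !(dotC x). Qed.

Lemma dotZl (R : realType) (d : nat) (a : R) (x y : 'rV[R]_d) :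
  dot (a *: y) x = a * dot y x.
Proof. by rewrite dotC dotZr (dotC x). Qed.

Lemma dotNr (R : realType) (d : nat) (x y : 'rV[R]_d) : dot x (- y) = - dot x y.
Proof. by rewrite -scaleN1r dotZr mulN1r. Qed.

Lemma dotNl (R : realType) (d : nat) (x y : 'rV[R]_d) : dot (- x) y = - dot x y.
Proof. by rewrite dotC dotNr dotC. Qed.

Definition dotE := (dotDr, dotDl, dotZr, dotZl, dotNr, dotNl).

Lemma dot0r (R : realType) (d : nat) (x : 'rV[R]_d) : dot x 0 = 0.
Proof. by rewrite -(scale0r 0) dotZr mul0r. Qed.

Lemma dot_mulmx (R : realType) (d : nat) (x y : 'rV[R]_d) (M : 'M[R]_d) :
  dot (x *m M) y = dot x (y *m M^T).
Proof.
have dotM (a b : 'rV[R]_d) : dot a b = (a *m b^T) 0 0.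
  by rewrite mxE; apply: eq_bigr => i _; rewrite mxE.
by rewrite !dotM trmx_mul trmxK mulmxA.
Qed.

Lemma dot_ge0 (R : realType) (d : nat) (x : 'rV[R]_d) : 0 <= dot x x.
Proof. by apply: sumr_ge0 => i _; rewrite -expr2 sqr_ge0. Qed.

Lemma dot_eq0 (R : realType) (d : nat) (x : 'rV[R]_d) : dot x x = 0 -> x = 0.
Proof.
move=> /eqP; rewrite psumr_eq0 => [/allP x0|i _]; last by rewrite -expr2 sqr_ge0.
apply/rowP => i; rewrite mxE; apply/eqP.
by have := x0 i (mem_index_enum _); rewrite mulf_eq0 orbb.
Qed.

Lemma enorm_ge0 (R : realType) (d : nat) (x : 'rV[R]_d) : 0 <= enorm x.
Proof. exact: sqrtr_ge0. Qed.

Lemma sqr_enorm (R : realType) (d : nat) (x : 'rV[R]_d) : enorm x ^+ 2 = dot x x.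
Proof. by rewrite sqr_sqrtr // dot_ge0. Qed.

Lemma enorm0_eq0 (R : realType) (d : nat) (x : 'rV[R]_d) : enorm x = 0 -> x = 0.
Proof. by move=> x0; apply: dot_eq0; rewrite -sqr_enorm x0 expr0n. Qed.

Lemma enormZ (R : realType) (d : nat) (a : R) (x : 'rV[R]_d) :
  enorm (a *: x) = `|a| * enorm x.
Proof.
by rewrite /enorm dotZl dotZr mulrA -expr2 sqrtrM ?sqr_ge0 // sqrtr_sqr.
Qed.

Lemma enormN (R : realType) (d : nat) (x : 'rV[R]_d) : enorm (- x) = enorm x.
Proof. by rewrite /enorm dotNl dotNr opprK. Qed.

Lemma enorm0 (R : realType) (d : nat) : enorm (0 : 'rV[R]_d) = 0.
Proof. by rewrite /enorm dot0r sqrtr0. Qed.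

Lemma cauchy_schwarz (R : realType) (d : nat) (x y : 'rV[R]_d) :
  `|dot x y| <= enorm x * enorm y.
Proof.
have [x0|x0] := eqVneq (enorm x) 0.
  by rewrite (enorm0_eq0 x0) dotC dot0r normr0 enorm0 mul0r.
have xp : 0 < enorm x by rewrite lt_def x0 enorm_ge0.
rewrite -ler_sqr ?nnegrE ?mulr_ge0 ?enorm_ge0 // real_normK ?num_real //.
have := dot_ge0 ((dot x x) *: y - (dot x y) *: x).
rewrite !dotE (dotC y x) exprMn !sqr_enorm => h.
have xx : 0 < dot x x by rewrite -sqr_enorm exprn_gt0.
rewrite -(ler_pM2l xx) -subr_ge0; apply: le_trans h _.
by rewrite le_eqVlt; apply/orP; left; apply/eqP; ring.
Qed.

Lemma dot_le_enorm (R : realType) (d : nat) (x y : 'rV[R]_d) :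
  dot x y <= enorm x * enorm y.
Proof. exact: le_trans (ler_norm _) (cauchy_schwarz _ _). Qed.

Lemma enormD (R : realType) (d : nat) (x y : 'rV[R]_d) :
  enorm (x + y) <= enorm x + enorm y.
Proof.
rewrite -ler_sqr ?nnegrE ?addr_ge0 ?enorm_ge0 // sqrrD !sqr_enorm !dotE.
have := dot_le_enorm x y; rewrite (dotC y x); lra.
Qed.

Lemma coord_le_enorm (R : realType) (d : nat) (x : 'rV[R]_d) i :
  `|x 0 i| <= enorm x.
Proof.
rewrite -ler_sqr ?nnegrE ?enorm_ge0 // real_normK ?num_real // sqr_enorm.
rewrite /dot (bigD1 i) //= -expr2 lerDl sumr_ge0 // => j _.
by rewrite -expr2 sqr_ge0.
Qed.

Lemma dot_continuous (R : realType) (d : nat) (u : 'rV[R]_d) : continuous (dot u).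
Proof.
apply: sum_continuous_fun => i x; apply: continuousM; first exact: cst_continuous.
exact: coord_rV_continuous.
Qed.

Lemma enorm_continuous (R : realType) (d : nat) :
  continuous (@enorm R d).
Proof.
move=> x; apply: (@continuous_comp _ _ _ (fun x => dot x x) (@Num.sqrt R)).
  apply: (@sum_continuous_fun _ _ _ (fun i (x : 'rV[R]_d) => x 0 i * x 0 i)).
  by move=> i y; apply: continuousM; exact: coord_rV_continuous.
exact: sqrt_continuous.
Qed.

Lemma closed_le_fun (T : topologicalType) (R : realType) (f : T -> R) (a : R) :
  continuous f -> closed [set x | f x <= a].
Proof.
move=> cf; apply: (@closed_comp _ _ f [set y | y <= a]); last exact: closed_le.
by move=> x _; exact: cf.
Qed.

Lemma closed_ge_fun (T : topologicalType) (R : realType) (f : T -> R) (a : R) :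
  continuous f -> closed [set x | a <= f x].
Proof.
move=> cf; apply: (@closed_comp _ _ f [set y | a <= y]); last exact: closed_ge.
by move=> x _; exact: cf.
Qed.

(** The empty set is a convex body, so that parts and sections by a hyperplane are convex bodies
    without any condition. *)
Definition convex_body (R : realType) (d : nat) (A : set 'rV[R]_d) : Prop :=
  compact A /\ forall x y t, A x -> A y -> 0 <= t <= 1 ->
    A ((1 - t) *: x + t *: y).

Lemma compact_bounded_coord (R : realType) (d : nat) (A : set 'rV[R]_d) r :
  closed A -> (forall x, A x -> forall i, `|x 0 i| <= r) -> compact A.
Proof.
move=> cA Ar; apply: (subclosed_compact cA (B := [set v : 'rV[R]_d |
  forall i, `[- r, r]%classic (v ord0 i)])).
  by apply: (@rV_compact _ _ (fun=> `[- r, r]%classic)) => _; exact: segment_compact.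
by move=> x Ax i /=; rewrite in_itv /= -ler_norml; exact: Ar.
Qed.

Lemma unit_ball_body (R : realType) (d : nat) : convex_body (@unit_ball R d).
Proof.
split.
  apply: (@compact_bounded_coord _ _ _ 1).
    exact: (closed_le_fun (@enorm_continuous R d)).
  by move=> x x1 i; rewrite (le_trans (coord_le_enorm _ _)).
move=> x y t; rewrite /unit_ball /= => x1 y1 /andP[t0 t1].
apply: le_trans (enormD _ _) _; rewrite !enormZ (ger0_norm t0) ger0_norm; nra.
Qed.

Lemma unit_cube_body (R : realType) (d : nat) : convex_body (@unit_cube R d).
Proof.
split.
  rewrite (_ : @unit_cube R d = [set v : 'rV[R]_d | forall i, `[0, 1]%classic (v ord0 i)]) //.
  by apply: (@rV_compact _ _ (fun=> `[0 : R, 1]%classic)) => _; exact: segment_compact.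
move=> x y t x1 y1 /andP[t0 t1] i; rewrite !mxE.
move: (x1 i) (y1 i) => /andP[? ?] /andP[? ?]; apply/andP; split; nra.
Qed.

Lemma convex_body_measurable (R : realType) (d : nat) (A : set 'rV[R]_d) :
  convex_body A -> measurable (A : set (mrV R d)).
Proof.
move=> [cA _]; apply: measurable_rV_closed; exact: compact_closed.
Qed.

Definition minksum (R : realType) (d : nat) (A B : set 'rV[R]_d) : set 'rV[R]_d :=
  [set x + y | x in A & y in B].

Lemma minksum_body (R : realType) (d : nat) (A B : set 'rV[R]_d) :
  convex_body A -> convex_body B -> convex_body (minksum A B).
Proof.
move=> [cA xA] [cB xB]; split.
  rewrite (_ : minksum A B = (fun xy => xy.1 + xy.2) @` (A `*` B)).
    apply: continuous_compact; last exact: compact_setX.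
    by apply: continuous_subspaceT => x; exact: add_continuous.
  apply/seteqP; split => z.
    by move=> [x Ax [y By <-]]; exists (x, y).
  by move=> [[x y] [/= Ax By] <-]; exists x => //; exists y.
move=> _ _ t [x Ax [y By <-]] [x' Ax' [y' By' <-]] t01.
exists ((1 - t) *: x + t *: x'); first exact: xA.
exists ((1 - t) *: y + t *: y'); first exact: xB.
by rewrite !scalerDr addrACA.
Qed.

Lemma mulmx_body (R : realType) (m n : nat) (M : 'M[R]_(m, n)) (A : set 'rV[R]_m) :
  convex_body A -> convex_body ((fun x => x *m M) @` A).
Proof.
move=> [cA xA]; split.
  apply: continuous_compact => //.
  by apply: continuous_subspaceT; exact: mulmx_continuous.
move=> _ _ t [x Ax <-] [y Ay <-] t01.
exists ((1 - t) *: x + t *: y); first exact: xA.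
by rewrite mulmxDl !scalemxAl.
Qed.

Lemma scale_body (R : realType) (d : nat) (a : R) (A : set 'rV[R]_d) :
  convex_body A -> convex_body ((fun x => a *: x) @` A).
Proof.
move=> bA; rewrite (_ : (fun x => _) = (fun x => x *m a%:M)).
  exact: mulmx_body.
by apply/funext => x; rewrite mul_mx_scalar.
Qed.

Lemma set1_body (R : realType) (d : nat) (x : 'rV[R]_d) : convex_body [set x].
Proof.
split; first exact: compact_set1.
by move=> _ _ t -> -> _ /=; rewrite -scalerDl subrK scale1r.
Qed.

Lemma set0_body (R : realType) (d : nat) : convex_body (@set0 'rV[R]_d).
Proof. by split; first exact: compact0. Qed.

Lemma translate_body (R : realType) (d : nat) (c : 'rV[R]_d) (A : set 'rV[R]_d) :
  convex_body A -> convex_body ((fun x => c + x) @` A).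
Proof.
move=> bA; rewrite (_ : _ @` A = minksum [set c] A).
  by apply: minksum_body => //; exact: set1_body.
apply/seteqP; split => z; first by move=> [x Ax <-]; exists c => //; exists x.
by move=> [_ -> [x Ax <-]]; exists x.
Qed.

Lemma upper_body (R : realType) (d : nat) (A : set 'rV[R]_d) p u :
  convex_body A -> convex_body (upper_part A p u).
Proof.
move=> [cA xA]; split.
  apply: compact_closedI => //; exact: (closed_ge_fun (@dot_continuous R d u)).
move=> x y t [Ax px] [Ay py] /andP[t0 t1]; split; first exact/xA/andP.
by rewrite !dotE; nra.
Qed.

Lemma lower_body (R : realType) (d : nat) (A : set 'rV[R]_d) p u :
  convex_body A -> convex_body (lower_part A p u).
Proof.
move=> [cA xA]; split.
  apply: compact_closedI => //; exact: (closed_le_fun (@dot_continuous R d u)).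
move=> x y t [Ax px] [Ay py] /andP[t0 t1]; split; first exact/xA/andP.
by rewrite !dotE; nra.
Qed.

Lemma sectionE (R : realType) (d : nat) (A : set 'rV[R]_d) p u :
  section A p u = lower_part (upper_part A p u) p u.
Proof.
apply/seteqP; split => x; first by move=> [Ax <-].
by move=> [[Ax px] xp]; split => //; apply/eqP; rewrite eq_le xp.
Qed.

Lemma section_body (R : realType) (d : nat) (A : set 'rV[R]_d) p u :
  convex_body A -> convex_body (section A p u).
Proof. by move=> bA; rewrite sectionE; apply/lower_body/upper_body. Qed.

Lemma parallel_bodyE (R : realType) (d : nat) (K : set 'rV[R]_d) eps :
  parallel_body K eps = minksum K ((fun x => eps *: x) @` @unit_ball R d).
Proof.
apply/seteqP; split => z.
  by move=> [x [b [Kx Bb ->]]]; exists x => //; exists (eps *: b) => //; exists b.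
by move=> [x Kx [_ [b Bb <-] <-]]; exists x, b.
Qed.

Lemma parallel_body_body (R : realType) (d : nat) (K : set 'rV[R]_d) eps :
  convex_body K -> convex_body (parallel_body K eps).
Proof.
move=> bK; rewrite parallel_bodyE; apply: minksum_body => //.
exact/scale_body/unit_ball_body.
Qed.

(** * Volume of convex bodies *)

Lemma compact_convex_itv (R : realType) (A : set R) : compact A -> A !=set0 ->
  (forall x y t, A x -> A y -> 0 <= t <= 1 -> A ((1 - t) * x + t * y)) ->
  exists a b, a <= b /\ A = `[a, b]%classic.
Proof.
move=> cA A0 xA.
have cid : {within A, continuous (@id R)} by apply: continuous_subspaceT => x; exact: cvg_id.
have [b /[!inE] Ab bA] := compact_EVT_max A0 cA cid.
have [a /[!inE] Aa aA] := compact_EVT_min A0 cA cid.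
have ab : a <= b by apply: aA; rewrite inE.
exists a, b; split => //; apply/seteqP; split => x /=; rewrite in_itv /=.
  by move=> Ax; apply/andP; split; [apply: aA|apply: bA]; rewrite inE.
move=> /andP[ax xb].
have [ab0|ab0] := eqVneq a b; first by have -> : x = a by lra.
have ba : 0 < b - a by rewrite subr_gt0 lt_neqAle ab0.
rewrite (_ : x = (1 - (x - a) / (b - a)) * a + (x - a) / (b - a) * b).
  apply: xA => //; rewrite divr_ge0 ?subr_ge0 // ler_pdivrMr // mul1r lerB //.
by field; rewrite gt_eqF.
Qed.

Lemma cube_body (R : realType) (d : nat) (r : R) :
  convex_body [set x : 'rV[R]_d | forall i, `|x 0 i| <= r].
Proof.
split.
  rewrite (_ : [set _ | _] = [set v : 'rV[R]_d |
      forall i, `[- r, r]%classic (v ord0 i)]).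
    apply: (@rV_compact _ _ (fun=> `[- r, r]%classic)) => _.
    exact: segment_compact.
  by apply/seteqP; split => x /= xr i; have := xr i; rewrite in_itv /= ler_norml.
move=> x y t xr yr /andP[t0 t1] i; rewrite !mxE.
rewrite (le_trans (ler_normD _ _)) // !normrM (ger0_norm t0) ger0_norm ?subr_ge0 //.
by have := xr i; have := yr i; nra.
Qed.

Lemma vol_cube (R : realType) (d : nat) (r : R) : 0 <= r ->
  vol [set x : 'rV[R]_d | forall i, `|x 0 i| <= r] = ((r *+ 2) ^+ d)%:E.
Proof.
move=> r0; elim: d => [|d ih]; first by rewrite /= indicE mem_set // => -[].
rewrite vol_succ.
transitivity (\int[@lebesgue_measure R]_(x in [set` `[(- r)%R, r]])
    ((r *+ 2) ^+ d)%:E)%E.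
  rewrite [RHS]integral_mkcond; apply: eq_integral => x _; rewrite patchE.
  case: ifPn => xr; rewrite ?inE ?notin_setE /= in_itv /= -ler_norml in xr.
    rewrite -ih; congr (vol _); apply/seteqP; split => y /= yr i.
      by have := yr (lift ord0 i); rewrite consrVS.
    by have [j ->|->] := unliftP ord0 i; rewrite ?consrVS ?consrV0.
  rewrite (_ : [set _ | _] = set0).
    by have [mu ->] := vol_measure R d; rewrite measure0.
  by apply/seteqP; split => y //= /(_ ord0); rewrite consrV0.
rewrite integral_cst //= lebesgue_measure_itv /= lte_fin.
case: ifPn => [_|]; first by rewrite -EFinD -EFinM exprSr opprK mulr2n.
rewrite -leNgt => rr; have -> : r = 0 by lra.
by rewrite mule0 mul0rn expr0n.
Qed.

Lemma convex_body_bounded (R : realType) (d : nat) (A : set 'rV[R]_d) :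
  convex_body A -> exists2 r, 0 < r & forall x, A x -> enorm x <= r.
Proof.
move=> [cA _]; have [->|A0] := eqVneq A set0; first by exists 1.
have /set0P A0' := A0.
have [|c _ cm] := compact_EVT_max (f := @enorm R d) A0' cA.
  by apply: continuous_subspaceT; exact: enorm_continuous.
exists (enorm c + 1); first by rewrite ltr_wpDl ?enorm_ge0.
by move=> x Ax; rewrite (le_trans (cm x _)) ?inE // lerDl.
Qed.

Lemma vol_body_lty (R : realType) (d : nat) (A : set 'rV[R]_d) :
  convex_body A -> (vol A < +oo)%E.
Proof.
move=> bA; have [r r0 Ar] := convex_body_bounded bA.
apply: (@le_lt_trans _ _ (vol [set x : 'rV[R]_d | forall i, `|x 0 i| <= r])).
  apply: le_vol; [exact: convex_body_measurable| |].
    by apply: convex_body_measurable; exact: cube_body.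
  by move=> x /Ar xr i; exact: le_trans (coord_le_enorm _ _) xr.
by rewrite vol_cube ?ltry // ltW.
Qed.

(** Nothing is lost by [fine] on convex bodies, whose volume is finite by [vol_body_lty]. *)
Definition volr (R : realType) (d : nat) (A : set 'rV[R]_d) : R := fine (vol A).

Lemma volrE (R : realType) (d : nat) (A : set 'rV[R]_d) :
  convex_body A -> vol A = (volr A)%:E.
Proof.
by move=> bA; rewrite fineK // ge0_fin_numE ?vol_ge0 // vol_body_lty.
Qed.

Lemma volr_ge0 (R : realType) (d : nat) (A : set 'rV[R]_d) : 0 <= volr A.
Proof. by rewrite fine_ge0 // vol_ge0. Qed.

Lemma le_volr (R : realType) (d : nat) (A B : set 'rV[R]_d) :
  convex_body A -> convex_body B -> A `<=` B -> volr A <= volr B.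
Proof.
move=> bA bB AB; rewrite -lee_fin -!volrE //.
by apply: le_vol => //; exact: convex_body_measurable.
Qed.

Lemma volr_modular (R : realType) (d : nat) (A B : set 'rV[R]_d) :
  convex_body A -> convex_body B -> convex_body (A `|` B) ->
  convex_body (A `&` B) ->
  volr (A `|` B) + volr (A `&` B) = volr A + volr B.
Proof.
move=> bA bB bU bI; apply/eqP; rewrite -eqe !EFinD -!volrE //; apply/eqP.
by apply: vol_modular; [exact: convex_body_measurable..|exact: vol_body_lty].
Qed.

Lemma volr_set0 (R : realType) (d : nat) : volr (@set0 'rV[R]_d) = 0.
Proof. by rewrite /volr; have [mu ->] := vol_measure R d; rewrite measure0. Qed.

Lemma volr_translate (R : realType) (d : nat) (c : 'rV[R]_d) (A : set 'rV[R]_d) :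
  convex_body A -> volr ((fun x => c + x) @` A) = volr A.
Proof.
move=> bA; rewrite /volr -[in RHS](vol_translation (- c)); last first.
  exact: convex_body_measurable.
congr (fine (vol _)); apply/seteqP; split => x.
  by move=> [y Ay <-] /=; rewrite addKr.
by move=> /= Ax; exists (- c + x); rewrite // addNKr.
Qed.

(** * Volume under orthogonal maps and dilations *)

Definition orthogonal_mx (R : realType) (d : nat) (M : 'M[R]_d) : Prop :=
  M *m M^T = 1%:M.

Lemma orthogonal_dot (R : realType) (d : nat) (M : 'M[R]_d) (x y : 'rV[R]_d) :
  orthogonal_mx M -> dot (x *m M) (y *m M) = dot x y.
Proof. by move=> oM; rewrite dot_mulmx -mulmxA oM mulmx1. Qed.

Lemma orthogonal_enorm (R : realType) (d : nat) (M : 'M[R]_d) (x : 'rV[R]_d) :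
  orthogonal_mx M -> enorm (x *m M) = enorm x.
Proof. by move=> oM; rewrite /enorm orthogonal_dot. Qed.

(** The ball contains the cube of half side 1/(d+1), whose points have squared norm at most
    d/(d+1). *)
Lemma volr_ball_gt0 (R : realType) (d : nat) : 0 < volr (@unit_ball R d).
Proof.
pose r : R := (d.+1)%:R^-1.
have r0 : 0 < r by rewrite invr_gt0.
pose Q := [set x : 'rV[R]_d | forall i, `|x 0 i| <= r].
have rd : vol Q = ((r *+ 2) ^+ d)%:E by apply: vol_cube; exact: ltW.
have QB : Q `<=` @unit_ball R d.
  move=> x xr; rewrite /unit_ball /= -ler_sqr ?nnegrE ?enorm_ge0 // sqr_enorm.
  apply: (@le_trans _ _ (\sum_(i < d) r)).
    apply: ler_sum => i _; rewrite -expr2 -(real_normK (num_real (x 0 i))) expr2.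
    have r1 : r <= 1 by rewrite invf_le1 // ler1n.
    by have := xr i; have := normr_ge0 (x 0 i); nra.
  rewrite sumr_const card_ord expr1n -mulr_natl /r ler_pdivrMr // mul1r.
  by rewrite ler_nat.
rewrite -lte_fin -volrE; last exact: unit_ball_body.
apply: (@lt_le_trans _ _ (vol Q)).
  by rewrite rd lte_fin exprn_gt0 // pmulrn_rgt0.
apply: le_vol => //; apply: convex_body_measurable; first exact: cube_body.
exact: unit_ball_body.
Qed.

(** This is [vol_mulmx_swap] with the unit ball as the other set: the ball is its own preimage, so
    its positive volume cancels and no determinant is involved. *)
Lemma volr_orthogonal (R : realType) (d : nat) (M : 'M[R]_d) (A : set 'rV[R]_d) :
  orthogonal_mx M -> convex_body A -> volr ((fun x => x *m M) @` A) = volr A.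
Proof.
move=> oM bA; have oM' : M^T *m M = 1%:M by exact: mulmx1C.
have bB := @unit_ball_body R d.
have := vol_mulmx_swap (M := M^T) (N := M) oM (convex_body_measurable bB)
  (convex_body_measurable bA).
have -> : [set x | A (x *m M^T)] = (fun x => x *m M) @` A.
  apply/seteqP; split => x.
    by move=> /= Ax; exists (x *m M^T) => //; rewrite -mulmxA oM' mulmx1.
  by move=> [y Ay <-] /=; rewrite -mulmxA oM mulmx1.
have -> : [set x | unit_ball (- (x *m M^T))] = @unit_ball R d.
  apply/seteqP; split => x; rewrite /unit_ball /= enormN orthogonal_enorm //;
    by rewrite /orthogonal_mx trmxK.
have bMA := mulmx_body M bA.
rewrite !volrE // -!EFinM => -[] /(congr1 ( *%R (volr (@unit_ball R d))^-1)).
rewrite mulKf; last by rewrite gt_eqF ?volr_ball_gt0.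
by move=> ->; rewrite mulrCA mulVf ?mulr1 // gt_eqF ?volr_ball_gt0.
Qed.

(** Again [vol_mulmx_swap], now against the cube of half side 1, whose preimage is the cube of half
    side a; both volumes are known. *)
Lemma volr_scale (R : realType) (d : nat) (a : R) (A : set 'rV[R]_d) :
  0 < a -> convex_body A -> volr ((fun x => a *: x) @` A) = a ^+ d * volr A.
Proof.
move=> a0 bA; have an : a != 0 by rewrite gt_eqF.
pose Q := [set x : 'rV[R]_d | forall i, `|x 0 i| <= 1].
have mQ : measurable (Q : set (mrV R d)) 
  by apply: convex_body_measurable; exact: cube_body.
have h : a%:M *m (a^-1)%:M = 1%:M :> 'M[R]_d by rewrite -scalar_mxM mulfV.
have := vol_mulmx_swap h mQ (convex_body_measurable bA).
have -> : [set x | A (x *m (a^-1)%:M)] = (fun x => a *: x) @` A.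
  apply/seteqP; split => x.
    move=> /= Ax; exists (x *m (a^-1)%:M) => //.
    by rewrite mul_mx_scalar scalerA mulfV // scale1r.
  by move=> [y Ay <-] /=; rewrite mul_mx_scalar scalerA mulVf // scale1r.
have -> : [set x | Q (- (x *m (a^-1)%:M))] =
    [set x : 'rV[R]_d | forall i, `|x 0 i| <= a].
  apply/seteqP; split => x /= xa i; have := xa i;
    by rewrite mul_mx_scalar !mxE normrN normrM gtr0_norm ?invr_gt0 //
      mulrC ler_pdivrMr // mul1r.
have bMA := scale_body a bA.
have QE : vol Q = ((1 *+ 2) ^+ d)%:E by exact: vol_cube.
rewrite (volrE bA) (volrE bMA) QE vol_cube ?ltW // -!EFinM => -[].
rewrite -(mulr_natr a) exprMn => h1.
apply: (@mulIf _ (2%:R ^+ d)); first by rewrite expf_neq0 // pnatr_eq0.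
by rewrite mulrC h1; ring.
Qed.

(** * Zonotopes *)

Definition lin (R : realType) (m n : nat) (M : 'M[R]_(m, n)) (A : set 'rV[R]_m) :
  set 'rV[R]_n := [set x *m M | x in A].

Lemma lin_body (R : realType) (m n : nat) (M : 'M[R]_(m, n)) (A : set 'rV[R]_m) :
  convex_body A -> convex_body (lin M A).
Proof. exact: mulmx_body. Qed.

Lemma lin_minksum (R : realType) (m n : nat) (M : 'M[R]_(m, n)) (A B : set 'rV[R]_m) :
  lin M (minksum A B) = minksum (lin M A) (lin M B).
Proof.
apply/seteqP; split => z.
  move=> [_ [x Ax [y By <-]] <-]; exists (x *m M); first by exists x.
  by exists (y *m M); [exists y|rewrite mulmxDl].
move=> [_ [x Ax <-] [_ [y By <-] <-]]; exists (x + y); last by rewrite mulmxDl.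
by exists x => //; exists y.
Qed.

Lemma lin_lin (R : realType) (m n p : nat) (M : 'M[R]_(m, n)) (N : 'M[R]_(n, p))
    (A : set 'rV[R]_m) : lin N (lin M A) = lin (M *m N) A.
Proof.
apply/seteqP; split => z.
  by move=> [_ [x Ax <-] <-]; exists x; rewrite // mulmxA.
by move=> [x Ax <-]; exists (x *m M); [exists x|rewrite mulmxA].
Qed.

Lemma lin_subset (R : realType) (m n : nat) (M : 'M[R]_(m, n)) (A B : set 'rV[R]_m) :
  A `<=` B -> lin M A `<=` lin M B.
Proof. by move=> AB _ [x Ax <-]; exists x => //; exact: AB. Qed.

Lemma minksumA (R : realType) (d : nat) (A B C : set 'rV[R]_d) :
  minksum A (minksum B C) = minksum (minksum A B) C.
Proof.
apply/seteqP; split => z.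
  move=> [x Ax [_ [y By [w Cw <-]] <-]]; exists (x + y); first by exists x => //; exists y.
  by exists w; rewrite // addrA.
move=> [_ [x Ax [y By <-]] [w Cw <-]]; exists x => //; exists (y + w).
  by exists y => //; exists w.
by rewrite addrA.
Qed.

Lemma minksumC (R : realType) (d : nat) (A B : set 'rV[R]_d) : minksum A B = minksum B A.
Proof.
by apply/seteqP; split => z [x Ax [y By <-]]; exists y => //; exists x;
  rewrite // addrC.
Qed.

Lemma minksum_subset (R : realType) (d : nat) (A A' B B' : set 'rV[R]_d) :
  A `<=` A' -> B `<=` B' -> minksum A B `<=` minksum A' B'.
Proof.
by move=> AA BB _ [x Ax [y By <-]]; exists x; [exact: AA|exists y => //; exact: BB].
Qed.

Lemma minksum_set0 (R : realType) (d : nat) (A : set 'rV[R]_d) : minksum A [set 0] = A.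
Proof.
apply/seteqP; split => z; first by move=> [x Ax [_ -> <-]]; rewrite addr0.
by move=> Az; exists z => //; exists 0; rewrite // addr0.
Qed.

(** The segment from [- z] to [z] has length 2 |z|, whence the factors [*+ 2] below. *)
Definition seg (R : realType) (d : nat) (z : 'rV[R]_d) : set 'rV[R]_d :=
  [set s *: z | s in `[- 1, 1]%classic].

Lemma seg_body (R : realType) (d : nat) (z : 'rV[R]_d) : convex_body (seg z).
Proof.
split.
  apply: continuous_compact; last exact: segment_compact.
  apply: continuous_subspaceT; apply: rV_continuous => i.
  under eq_fun do rewrite mxE.
  by move=> x; apply: continuousM; [exact: cvg_id|exact: cst_continuous].
move=> _ _ t [a /= a1 <-] [b /= b1 <-] /andP[t0 t1].
rewrite !in_itv /= in a1 b1; move: a1 b1 => /andP[a0 a1] /andP[b0 b1].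
exists ((1 - t) * a + t * b); last by rewrite !scalerA -scalerDl.
by rewrite /= in_itv /=; apply/andP; split; nra.
Qed.

Lemma seg0 (R : realType) (d : nat) : seg (0 : 'rV[R]_d) = [set 0].
Proof.
apply/seteqP; split => z; first by move=> [a _ <-]; rewrite scaler0.
by move=> ->; exists 0; rewrite ?scaler0 //= in_itv /=; lra.
Qed.

Lemma lin_seg (R : realType) (m n : nat) (M : 'M[R]_(m, n)) (z : 'rV[R]_m) :
  lin M (seg z) = seg (z *m M).
Proof.
apply/seteqP; split => w.
  by move=> [_ [a a1 <-] <-]; exists a => //; rewrite scalemxAl.
by move=> [a a1 <-]; exists (a *: z); [exists a|rewrite scalemxAl].
Qed.

Definition tailmx (R : realType) (d : nat) : 'M[R]_(d.+1, d) :=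
  rsubmx (1%:M : 'M[R]_(1 + d)).

Lemma consrV_tail (R : realType) (d : nat) (x : R) (y : 'rV[R]_d) :
  consrV (x, y) *m tailmx R d = y.
Proof.
have := @mulmx_rsub R 1 (1 + d) 1 d (consrV (x, y)) 1%:M.
by rewrite mulmx1 /consrV row_mxKr.
Qed.

Lemma consrVD (R : realType) (d : nat) (x x' : R) (y y' : 'rV[R]_d) :
  consrV (x, y) + consrV (x', y') = consrV (x + x', y + y').
Proof.
apply/rowP => i; have [j ->|->] := unliftP ord0 i; rewrite [LHS]mxE.
  by rewrite !consrVS mxE.
by rewrite !consrV0.
Qed.

Lemma consrVZ (R : realType) (d : nat) (a x : R) (y : 'rV[R]_d) :
  a *: consrV (x, y) = consrV (a * x, a *: y).
Proof.
apply/rowP => i; have [j ->|->] := unliftP ord0 i; rewrite [LHS]mxE.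
  by rewrite !consrVS mxE.
by rewrite !consrV0.
Qed.

Lemma consrVP (R : realType) (d : nat) (z : 'rV[R]_d.+1) :
  exists x y, z = consrV (x, y).
Proof. by exists (z 0 0), (\row_i z 0 (lift ord0 i)); rewrite consrVK. Qed.

Lemma dot_consrV (R : realType) (d : nat) (x x' : R) (y y' : 'rV[R]_d) :
  dot (consrV (x, y)) (consrV (x', y')) = x * x' + dot y y'.
Proof.
rewrite /dot big_ord_recl !consrV0; congr (_ + _).
by apply: eq_bigr => i _; rewrite !consrVS.
Qed.

Lemma lebesgue_closed_itv (R : realType) (a b : R) : a <= b ->
  @lebesgue_measure R `[a, b]%classic = (b - a)%:E.
Proof.
move=> ab; rewrite lebesgue_measure_itv /= lte_fin.
have [ab'|ba] := ltP a b; first by rewrite -EFinD.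
by have -> : a = b by [lra]; rewrite subrr.
Qed.

(** Fubini with the first coordinate innermost: over a point of the projection the fibre of A is an
    interval [a, b], which the segment widens to [a - t, b + t]; over other points both fibres are
    empty. *)
Lemma volr_minksum_seg_e0 (R : realType) (d : nat) (A : set 'rV[R]_d.+1) (t : R) :
  convex_body A -> 0 <= t ->
  volr (minksum A (seg (consrV (t, 0)))) =
  volr A + (t *+ 2) * volr (lin (tailmx R d) A).
Proof.
move=> bA t0; have [mu vol_mu] := vol_measure R d.
have bT := lin_body (tailmx R d) bA.
have bS := minksum_body bA (seg_body (consrV (t, 0))).
have volE (X : set 'rV[R]_d.+1) : convex_body X -> vol X =
    (\int[mu]_y @lebesgue_measure R [set x | X (consrV (x, y))])%E.
  move=> bX; rewrite vol_succ; under eq_integral do rewrite vol_mu.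
  apply: (integral_section_swap (@lebesgue_measure R) mu (A := [set xy | X (consrV xy)])).
  apply: (measurable_preim (@measurable_consrV R d)).
  exact: convex_body_measurable.
have msec (X : set 'rV[R]_d.+1) : convex_body X ->
    measurable_fun setT (fun y : mrV R d =>
      @lebesgue_measure R [set x | X (consrV (x, y))]).
  move=> bX.
  have mX : measurable ([set xy | X (consrV xy)] : set (measurableTypeR R * mrV R d)).
    apply: (measurable_preim (@measurable_consrV R d)).
    exact: convex_body_measurable.
  have := measurable_fun_ysection (@lebesgue_measure R) mX.
  congr measurable_fun; apply/funext => y /=; congr (lebesgue_measure _).
  by apply/seteqP; split => x; rewrite /ysection /= inE.
apply/eqP; rewrite -eqe EFinD EFinM -!volrE // !volE //; apply/eqP.
have -> : ((t *+ 2)%:E * vol (lin (tailmx R d) A) =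
    \int[mu]_y ((t *+ 2)%:E * (\1_(lin (tailmx R d) A) y)%:E))%E.
  rewrite ge0_integralZl //.
  - rewrite integral_indic ?setIT ?vol_mu //; exact: convex_body_measurable.
  - apply/measurable_EFinP; apply: measurable_indic; exact: convex_body_measurable.
  - by rewrite lee_fin mulrn_wge0.
rewrite -ge0_integralD //; last 3 first.
- exact: msec.
- by move=> y _; rewrite mule_ge0 // lee_fin mulrn_wge0.
- apply: measurable_funeM; apply/measurable_EFinP; apply: measurable_indic.
  exact: convex_body_measurable.
apply: eq_integral => y _; rewrite indicE.
have [yT|yT] := boolP (y \in lin (tailmx R d) A); last first.
  rewrite mule0 adde0; congr (lebesgue_measure _); apply/seteqP; split => x /=.
    move=> [z Az [_ [s _ <-]]].
    have [a [b zab]] := consrVP z.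
    rewrite zab consrVZ scaler0 consrVD addr0 => /(congr1 (fun z => z *m tailmx R d)).
    rewrite !consrV_tail => by_; move: yT; rewrite notin_setE => -[].
    by exists z; rewrite // zab consrV_tail.
  move=> Axy; move: yT; rewrite notin_setE => -[].
  by exists (consrV (x, y)); rewrite // consrV_tail.
rewrite mule1.
have [a [b [ab E]]] : exists a b, a <= b /\ [set x | A (consrV (x, y))] = `[a, b]%classic.
  apply: compact_convex_itv.
  - have [cA _] := bA.
    rewrite (_ : [set x | _] = (fun z : 'rV[R]_d.+1 => z 0 0) @`
        (A `&` [set z | z *m tailmx R d = y])).
      apply: continuous_compact.
        by apply: continuous_subspaceT; exact: coord_rV_continuous.
      apply: compact_closedI => //.
      apply: (@closed_comp 'rV[R]_d.+1 'rV[R]_d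
        (fun z => z *m tailmx R d) [set (y : 'rV[R]_d)]).
        by move=> z _; exact: mulmx_continuous.
      by apply: accessible_closed_set1; exact: hausdorff_accessible.
    apply/seteqP; split => x.
      move=> /= Ax; exists (consrV (x, y)); last exact: consrV0.
      by split => //=; rewrite consrV_tail.
    move=> [z [Az /= zy] <-] /=; have [a [b zab]] := consrVP z.
    by move: zy Az; rewrite zab consrV_tail => ->; rewrite consrV0.
  - move: yT; rewrite inE => -[z Az]; have [a [b zab]] := consrVP z.
    by rewrite zab consrV_tail => <-; exists a; rewrite /= -zab.
  - move=> x x' s /= Ax Ax' s01; have [_ /(_ _ _ _ Ax Ax' s01)] := bA.
    by rewrite !consrVZ consrVD -scalerDl subrK scale1r.
rewrite E (_ : [set x | _] = `[a - t, b + t]%classic).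
  transitivity ((b - a)%:E + (t *+ 2)%:E)%E.
    rewrite lebesgue_closed_itv; last lra.
    by rewrite -EFinD; congr (_%:E); rewrite mulr2n; ring.
  by congr (_ + _)%E; apply/esym; exact: lebesgue_closed_itv.
have AE x : A (consrV (x, y)) <-> a <= x <= b.
  have -> : A (consrV (x, y)) = [set x | A (consrV (x, y))] x by [].
  by rewrite E /= in_itv.
apply/seteqP; split => x /=; rewrite in_itv /=.
  move=> [z Az [_ [s /= s1 <-]]].
  rewrite in_itv /= in s1; move: s1 => /andP[s0 s1].
  have [a' [b' zab]] := consrVP z.
  rewrite zab consrVZ scaler0 consrVD addr0 => h.
  have <- : a' + s * t = x by rewrite -(consrV0 (a' + s * t) b') h consrV0.
  have b'y : b' = y by rewrite -(consrV_tail (a' + s * t) b') h consrV_tail.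
  have /AE/andP[? ?] : A (consrV (a', y)) by rewrite -b'y -zab.
  by apply/andP; split; nra.
move=> /andP[xa xb].
have [t00|t00] := eqVneq t 0.
  exists (consrV (x, y)); first by apply/AE; lra.
  exists 0; last by rewrite addr0.
  by exists 0; rewrite ?scale0r //= in_itv /=; lra.
have tp : 0 < t by rewrite lt_def t00.
(* The point of [a, b] nearest to x. *)
have [x' [x'ab xx']] : exists x', a <= x' <= b /\ - t <= x - x' <= t.
  have [ax|ax] := lerP x a; first by exists a; split; lra.
  by have [bx|bx] := lerP x b; [exists x|exists b]; split; lra.
exists (consrV (x', y)); first exact/AE.
exists (consrV (x - x', 0)); last by rewrite consrVD addr0 addrC subrK.
exists ((x - x') / t); last by rewrite consrVZ scaler0 divfK.
by rewrite /= in_itv /= ler_pdivlMr // ler_pdivrMr //; lra.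
Qed.

(** The Householder reflection in the hyperplane orthogonal to [x - y]. Below it moves a direction
    onto the first axis, spreads small widths over the sphere, and mirrors a cylinder. *)
Lemma exists_reflection (R : realType) (d : nat) (x y : 'rV[R]_d) :
  enorm x = enorm y ->
  exists M : 'M[R]_d, [/\ orthogonal_mx M, M^T = M, x *m M = y &
    forall z, dot z (x - y) = 0 -> z *m M = z].
Proof.
move=> xy; pose v := x - y; pose c := dot v v.
have vv : v *m v^T = c%:M.
  apply/matrixP => i j; rewrite !ord1 !mxE eqxx mulr1n /c.
  by apply: eq_bigr => k _; rewrite [v^T _ _]mxE.
(* If x = y then c = 0, and [2 / c] is 0 by convention, so that M is the identity. *)
pose M : 'M[R]_d := 1%:M - (2 / c) *: (v^T *m v).
have MT : M^T = M.
  by rewrite /M linearB /= trmx1 linearZ /= trmx_mul trmxK.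
exists M; split => //.
- rewrite /orthogonal_mx MT; pose P : 'M[R]_d := (2 / c) *: (v^T *m v).
  have PP : P *m P = 2 *: P.
    rewrite /P -scalemxAl -scalemxAr mulmxA -(mulmxA v^T) vv mul_mx_scalar.
    rewrite -scalemxAl !scalerA; congr (_ *: _).
    have [->|c0] := eqVneq c 0; first by rewrite invr0; ring.
    by field.
  rewrite -[M]/(1%:M - P) mulmxBl mul1mx [P *m _]mulmxBr PP mulmx1.
  by rewrite scaler_nat mulr2n opprB addrK subrK.
- have xx : dot x x = dot y y by rewrite -!sqr_enorm xy.
  have xv : x *m v^T = (c / 2)%:M.
    apply/matrixP => i j; rewrite !ord1 !mxE eqxx mulr1n.
    transitivity (dot x v); first by apply: eq_bigr => k _; rewrite [v^T _ _]mxE.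
    by rewrite /c /v !dotE xx (dotC y x); field.
  rewrite /M mulmxBr mulmx1 -scalemxAr mulmxA xv mul_scalar_mx scalerA.
  have [c0|c0] := eqVneq c 0.
    have v0 : v = 0 by apply: dot_eq0.
    by rewrite v0 scaler0 subr0; apply/eqP; rewrite -subr_eq0 -/v v0.
  rewrite (_ : 2 / c * (c / 2) = 1) ?scale1r ?subKr //.
  by field.
- move=> z zv; rewrite /M mulmxBr mulmx1 -scalemxAr mulmxA.
  have -> : z *m v^T = 0.
    apply/matrixP => i j; rewrite !ord1 !mxE -[RHS]zv.
    by apply: eq_bigr => k _; rewrite [v^T _ _]mxE.
  by rewrite mul0mx scaler0 subr0.
Qed.

Lemma enorm_consrV0 (R : realType) (d : nat) (t : R) :
  0 <= t -> enorm (consrV (t, 0) : 'rV[R]_d.+1) = t.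
Proof. by move=> t0; rewrite /enorm dot_consrV dot0r addr0 -expr2 sqrtr_sqr ger0_norm. Qed.

(** A reflection taking z to the first axis reduces this to [volr_minksum_seg_e0]. The matrix M
    depends on z alone: one projection serves all bodies and all lengths. *)
Lemma volr_minksum_seg (R : realType) (d : nat) (z : 'rV[R]_d.+1) :
  exists M : 'M[R]_(d.+1, d), forall (A : set 'rV[R]_d.+1) (t : R),
    convex_body A -> 0 <= t ->
    volr (minksum A (seg (t *: z))) =
    volr A + (t * enorm z) *+ 2 * volr (lin M A).
Proof.
have [M [oM _ zM _]] := exists_reflection (esym (enorm_consrV0 d (enorm_ge0 z))).
exists (M *m tailmx R d) => A t bA t0.
rewrite -(volr_orthogonal oM); last exact: minksum_body (seg_body _).
rewrite -[_ @` _]/(lin M _) lin_minksum lin_seg -scalemxAl zM consrVZ scaler0.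
rewrite volr_minksum_seg_e0 ?mulr_ge0 ?enorm_ge0 //; last exact: lin_body.
by rewrite lin_lin -[lin M A]/(_ @` _) volr_orthogonal.
Qed.

Definition zonotope (R : realType) (d : nat) (s : seq 'rV[R]_d) : set 'rV[R]_d :=
  foldr (fun z => minksum (seg z)) [set 0] s.

Lemma zonotope_body (R : realType) (d : nat) (s : seq 'rV[R]_d) :
  convex_body (zonotope s).
Proof.
elim: s => [|z s ih] /=; first exact: set1_body.
exact: minksum_body (seg_body z) ih.
Qed.

Lemma lin_zonotope (R : realType) (m n : nat) (M : 'M[R]_(m, n)) (s : seq 'rV[R]_m) :
  lin M (zonotope s) = zonotope [seq z *m M | z <- s].
Proof.
elim: s => [|z s ih] /=; last by rewrite lin_minksum lin_seg ih.
apply/seteqP; split => x; first by move=> [_ -> <-]; rewrite mul0mx.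
by move=> ->; exists 0; rewrite // mul0mx.
Qed.

(** By [volr_minksum_seg] a generator z adds a factor eps times the volume of a projected sum, which
    has the same form with one dimension and one generator less; hence the induction on the number
    of generators for all d at once. The family c is chosen before K so that coefficients of nested
    bodies can be compared. *)
Lemma volr_zonotope_poly (R : realType) (d : nat) (s : seq 'rV[R]_d) :
  exists c : set 'rV[R]_d -> nat -> R, forall K, convex_body K ->
    [/\ forall k, 0 <= c K k,
        forall K', convex_body K' -> K `<=` K' -> forall k, c K k <= c K' k
      & forall eps, 0 <= eps ->
          volr (minksum K (zonotope [seq eps *: z | z <- s])) =
          \sum_(k < d.+1) c K k * eps ^+ k].
Proof.
have [n] := ubnP (size s); elim: n d s => // n ih [|d] [|z s] /= sn.
- exists (fun K k => if k is 0%N then volr K else 0) => K bK; split.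
  + by case=> [|k] //; exact: volr_ge0.
  + by move=> K' bK' KK' [|k] //; exact: le_volr.
  + by move=> eps _; rewrite minksum_set0 big_ord1 mulr1.
- have [c cP] := ih 0%N s sn; exists c => K bK; have [c0 cm cE] := cP K bK; split => // eps e0.
  rewrite -cE //; congr (volr (minksum K _)).
  have -> : eps *: z = 0 by apply/rowP => -[].
  rewrite seg0 minksumC minksum_set0 //.
- exists (fun K k => if k is 0%N then volr K else 0) => K bK; split.
  + by case=> [|k] //; exact: volr_ge0.
  + by move=> K' bK' KK' [|k] //; exact: le_volr.
  + move=> eps _; rewrite minksum_set0 big_ord_recl mulr1 big1 ?addr0 // => i _.
    by rewrite mul0r.
have [c1 c1P] := ih d.+1 s sn.
have [M ME] := volr_minksum_seg z.
have [c2 c2P] := ih d [seq z *m M | z <- s] (leq_trans (eq_leq (f_equal succn (size_map _ _))) sn).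
exists (fun K k => c1 K k + if k is k'.+1 then enorm z *+ 2 * c2 (lin M K) k' else 0).
move=> K bK; have [c10 c1m c1E] := c1P K bK.
have bMK := lin_body M bK; have [c20 c2m c2E] := c2P _ bMK.
split=> [[|k]|K' bK' KK' [|k]|eps e0].
- by rewrite addr0.
- by rewrite addr_ge0 // mulr_ge0 // mulrn_wge0 // enorm_ge0.
- by rewrite !addr0; exact: c1m.
- rewrite lerD ?c1m // ler_wpM2l // ?mulrn_wge0 ?enorm_ge0 //.
  by apply: c2m; [exact: lin_body|exact: lin_subset].
rewrite minksumC -minksumA minksumC [minksum _ K]minksumC.
have bZ := zonotope_body [seq eps *: z | z <- s].
rewrite ME //; last exact: minksum_body.
rewrite lin_minksum lin_zonotope -map_comp.
have -> : [seq (fun x => x *m M) (eps *: z) | z <- s] =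
    [seq eps *: z | z <- [seq z *m M | z <- s]].
  by rewrite -map_comp; apply: eq_map => w /=; rewrite scalemxAl.
rewrite c1E // c2E //.
under [RHS]eq_bigr do rewrite mulrDl.
rewrite big_split /=; congr (_ + _).
rewrite [RHS]big_ord_recl mul0r add0r mulr_sumr.
apply: eq_bigr => i _; rewrite /bump /= exprS -mulrnAr; ring.
Qed.

(** * Approximation of the ball by zonotopes *)

Lemma enormB_continuous (R : realType) (d : nat) (c : 'rV[R]_d) :
  continuous (fun x : 'rV[R]_d => enorm (x - c)).
Proof.
move=> x; apply: (@continuous_comp 'rV[R]_d 'rV[R]_d R (fun x => x - c) (@enorm R d)).
  by apply: continuousB; [exact: cvg_id|exact: cst_continuous].
exact: enorm_continuous.
Qed.

(** The vector x points to b from the point k0 of K nearest to b. Moving from k0 towards k by a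
    fraction t cannot decrease the distance to b, which for small t forces [dot x (k - k0) <= 0]. *)
Lemma convex_body_separation (R : realType) (d : nat) (K : set 'rV[R]_d)
    (b : 'rV[R]_d) : convex_body K -> K !=set0 -> ~ K b ->
  exists x, forall k, K k -> dot x k < dot x b.
Proof.
move=> [cK xK] K0 Kb.
have cf : {within K, continuous (fun k => enorm (k - b))}.
  exact/continuous_subspaceT/enormB_continuous.
have [k0 /[!inE] Kk0 k0m] := compact_EVT_min K0 cK cf.
exists (b - k0) => k Kk; set x := b - k0.
have xp : 0 < dot x x.
  rewrite lt_def dot_ge0 andbT; apply/eqP => /dot_eq0 x0; apply: Kb.
  by move: x0 => /eqP; rewrite subr_eq0 => /eqP ->.
have h t : 0 < t <= 1 -> dot x (k - k0) * 2 <= t * dot (k - k0) (k - k0).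
  move=> /andP[t0 t1].
  have Kt : K ((1 - t) *: k0 + t *: k) by apply: xK => //; rewrite (ltW t0).
  have := k0m ((1 - t) *: k0 + t *: k); rewrite inE => /(_ Kt).
  rewrite -ler_sqr ?nnegrE ?enorm_ge0 // !sqr_enorm.
  have -> : (1 - t) *: k0 + t *: k - b = - (x - t *: (k - k0)).
    by apply/rowP => i; rewrite !mxE; ring.
  have -> : k0 - b = - x by rewrite opprB.
  move: (k - k0) x {xp Kt k0m} => y x.
  rewrite !dotE (dotC y x) => h.
  by rewrite -(ler_pM2l t0); lra.
have kk : dot x (k - k0) <= 0.
  rewrite leNgt; apply/negP => kp.
  have h1 := h 1 ltac:(lra); rewrite mul1r in h1.
  set c := dot (k - k0) (k - k0) in h h1.
  have cp : 0 < c by lra.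
  (* With a = [dot x (k - k0)] > 0, this choice of t turns [h] into 2 a <= a. *)
  have := h (dot x (k - k0) / c) ltac:(apply/andP; split;
    [by rewrite divr_gt0|by rewrite ler_pdivrMr //; lra]).
  by rewrite divfK ?gt_eqF //; lra.
have : 0 < dot x (b - k0) by [].
by move: kk; rewrite !dotDr !dotNr; lra.
Qed.

(* The support function of the zonotope of s. *)
Definition width (R : realType) (d : nat) (s : seq 'rV[R]_d) (x : 'rV[R]_d) : R :=
  \sum_(z <- s) `|dot x z|.

Lemma widthZ (R : realType) (d : nat) (s : seq 'rV[R]_d) a x :
  width s (a *: x) = `|a| * width s x.
Proof.
by rewrite /width mulr_sumr; apply: eq_bigr => z _; rewrite dotZl normrM.
Qed.

Lemma width_scale (R : realType) (d : nat) (s : seq 'rV[R]_d) a x : 0 <= a ->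
  width [seq a *: z | z <- s] x = a * width s x.
Proof.
move=> a0; rewrite /width big_map mulr_sumr.
by apply: eq_bigr => z _; rewrite dotZr normrM ger0_norm.
Qed.

Lemma widthD (R : realType) (d : nat) (s : seq 'rV[R]_d) x y :
  width s (x + y) <= width s x + width s y.
Proof.
rewrite /width -big_split /=; apply: ler_sum => z _.
by rewrite dotDl ler_normD.
Qed.

Lemma zonotope_support (R : realType) (d : nat) (s : seq 'rV[R]_d) x z :
  zonotope s z -> dot x z <= width s x.
Proof.
elim: s z => [|w s ih] z /=; first by move=> ->; rewrite dot0r /width big_nil.
move=> [_ [a /= a1 <-] [y ys <-]]; rewrite /width big_cons dotDr lerD ?ih //.
rewrite dotZr (le_trans (ler_norm _)) // normrM ler_piMl //.
by rewrite ler_norml; rewrite in_itv in a1.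
Qed.

Lemma zonotope_attained (R : realType) (d : nat) (s : seq 'rV[R]_d) x :
  exists2 z, zonotope s z & dot x z = width s x.
Proof.
elim: s => [|w s [z zs zx]]; first by exists 0; rewrite ?dot0r /width ?big_nil.
exists (Num.sg (dot x w) *: w + z); last first.
  by rewrite dotDr zx dotZr /width big_cons normrEsg.
exists (Num.sg (dot x w) *: w); last by exists z.
exists (Num.sg (dot x w)) => //=; rewrite in_itv /= -ler_norml normr_sg.
by case: (dot x w != 0).
Qed.

(** Compares the support function with those of the balls of radii m and M, which are constant on
    the unit sphere. *)
Definition width_bounds (R : realType) (d : nat) (s : seq 'rV[R]_d) (m M : R) :=
  forall x, enorm x = 1 -> m <= width s x <= M.

Lemma width_bounds_scale (R : realType) (d : nat) (s : seq 'rV[R]_d) m M x :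
  width_bounds s m M -> m * enorm x <= width s x <= M * enorm x.
Proof.
move=> b; have [x0|x0] := eqVneq (enorm x) 0.
  rewrite x0 !mulr0 (enorm0_eq0 x0) /width big1 ?lexx // => z _.
  by rewrite dotC dot0r normr0.
have xp : 0 < enorm x by rewrite lt_def x0 enorm_ge0.
have -> : x = enorm x *: ((enorm x)^-1 *: x) by rewrite scalerA mulfV // scale1r.
set y := _^-1 *: x.
have y1 : enorm y = 1 by rewrite enormZ ger0_norm ?mulVf // invr_ge0 ltW.
rewrite widthZ enormZ y1 mulr1 ger0_norm ?enorm_ge0 // ![_ * enorm x]mulrC.
by rewrite !ler_pM2l //; exact: b.
Qed.

Lemma sphere_net (R : realType) (d : nat) (r : R) : 0 < r ->
  exists xs : seq 'rV[R]_d, (forall c, c \in xs -> enorm c = 1) /\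
    forall x, enorm x = 1 -> exists2 c, c \in xs & enorm (x - c) <= r.
Proof.
move=> r0; pose S := [set x : 'rV[R]_d | enorm x = 1].
have cS : compact S.
  have [cB _] := @unit_ball_body R d.
  rewrite (_ : S = @unit_ball R d `&` [set x | 1 <= enorm x]).
    exact: (compact_closedI cB (closed_ge_fun (@enorm_continuous R d))).
  apply/seteqP; split => x; rewrite /S /unit_ball /=; first by move=> ->.
  by move=> [x1 x2]; apply/eqP; rewrite eq_le x1.
move: cS; rewrite compact_cover.
move=> /(_ _ S (fun c => [set x | enorm (x - c) < r])) [c _|x Sx|D DS SD].
- apply: (@open_comp 'rV[R]_d R (fun x => enorm (x - c)) [set y | y < r]).
    by move=> x _; exact: enormB_continuous.
  exact: open_lt.
- by exists x => //=; rewrite subrr enorm0.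
exists (finmap.enum_fset D); split; first by move=> c /DS; rewrite inE.
by move=> x /SD[c /= cD /ltW]; exists c.
Qed.

(* Averaging over reflections sending each point c of a net of the sphere to
   a point y of small width spreads the small values over the whole sphere. *)
Lemma width_gap_step (R : realType) (d : nat) (M0 D : R) : 0 < M0 -> 0 < D ->
  exists2 q : R, 0 <= q < 1 & forall (s : seq 'rV[R]_d) m M,
    width_bounds s m M -> 1 <= m <= M -> M <= M0 -> D <= M - m ->
    exists (s' : seq 'rV[R]_d) m' M', [/\ width_bounds s' m' M', 1 <= m' <= M', M' <= M0 &
      M' - m' <= q * (M - m)].
Proof.
(* As [width s] is subadditive and at most M0 on the unit sphere, it increases by at most [D / 4]
   over a net radius. *)
move=> M00 D0; have [xs [xs1 xsr]] := @sphere_net R d (D / (4 * M0)) ltac:(by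
  rewrite divr_gt0 // mulr_gt0).
(* The factor q is fixed by the net, hence by D and M0, and not by s; [n.+1] avoids a division by
   zero. *)
pose n := size xs; have [e eE] : exists e : R, e = (4 * (n.+1)%:R)^-1 by exists (4 * (n.+1)%:R)^-1.
pose q : R := 1 - e.
have n4 : 4 <= 4 * (n.+1)%:R :> R by rewrite ler_peMr // ler1n.
have q1 : 0 < e by rewrite eE invr_gt0; lra.
have q2 : e <= 1 / 4 by rewrite eE div1r lef_pV2 ?posrE //; lra.
have q12 : 1 / 2 <= q by rewrite /q; lra.
exists q; first by rewrite /q; lra.
move=> s m M b /andP[m1 mM] MM0 DMm.
(* If no unit vector has width below the midpoint, m is raised to the midpoint and the gap is
   halved. *)
have [[y [y1 ym]]|noy] := pselect (exists y, enorm y = 1 /\ width s y < (m + M) / 2);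
    last first.
  exists s, ((m + M) / 2), M; split => //; [|lra|nra].
  move=> x x1; have /andP[_ ->] := b x x1; rewrite andbT leNgt.
  by apply/negP => xm; apply: noy; exists x.
have /choice[F FP] (c : 'rV[R]_d) : exists A : 'M[R]_d, enorm c = 1 ->
    [/\ orthogonal_mx A, A^T = A & c *m A = y].
  have [c1|c1] := eqVneq (enorm c) 1; last by exists 0 => c1'; rewrite c1' eqxx in c1.
  have [A [oA sA cA _]] := @exists_reflection R d c y (etrans c1 (esym y1)).
  by exists A.
have n0 : (0 < n)%N.
  by have [c cxs _] := xsr y y1; rewrite /n; case: (xs) cxs.
have n0R : 0 < n%:R :> R by rewrite ltr0n.
pose s' := flatten [seq [seq n%:R^-1 *: (z *m F c) | z <- s] | c <- xs].
have s'E x : width s' x = n%:R^-1 * \sum_(c <- xs) width s (x *m F c).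
  rewrite /width /s' big_flatten /= big_map mulr_sumr big_seq [RHS]big_seq.
  apply: eq_bigr => c cxs; rewrite big_map mulr_sumr; apply: eq_bigr => z _.
  have [_ sF _] := FP c (xs1 c cxs).
  by rewrite dotZr normrM ger0_norm ?invr_ge0 ?ler0n // dot_mulmx sF.
have bF x c : enorm x = 1 -> c \in xs -> m <= width s (x *m F c) <= M.
  move=> x1 cxs; apply: b; have [oF _ _] := FP c (xs1 c cxs).
  by rewrite orthogonal_enorm.
exists s', m, (M - (M - m) / (4 * n%:R)); split.
- move=> x x1; rewrite s'E; apply/andP; split.
    rewrite ler_pdivlMl //.
    have -> : n%:R * m = \sum_(c <- xs) m.
      by rewrite big_const_seq count_predT iter_addr_0 mulr_natl.
    rewrite big_seq [leRHS]big_seq; apply: ler_sum => c cxs.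
    by have /andP[] := bF x c x1 cxs.
  have [c cxs xc] := xsr x x1.
  rewrite ler_pdivrMl // mulrC.
  (* The reflection of a net point c close to x brings x close to y. This one summand stays a
     quarter of the gap below M, so the mean over the n reflections stays [(M - m) / (4 * n)] below
     M. *)
  have hc : width s (x *m F c) <= M - (M - m) / 4.
    have -> : x *m F c = y + (x - c) *m F c.
      by have [_ _ <-] := FP c (xs1 c cxs); rewrite mulmxBl addrC subrK.
    apply: le_trans (widthD _ _ _) _.
    have /andP[_] := width_bounds_scale ((x - c) *m F c) b.
    have [oF _ _] := FP c (xs1 c cxs); rewrite orthogonal_enorm // => h.
    have : M * enorm (x - c) <= M0 * (D / (4 * M0)).
      by apply: ler_pM => //; [lra|exact: enorm_ge0].
    rewrite (_ : M0 * _ = D / 4); last by field; rewrite gt_eqF.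
    lra.
  rewrite (big_rem c) //=.
  have : \sum_(c' <- rem c xs) width s (x *m F c') <= \sum_(c' <- rem c xs) M.
    rewrite big_seq [leRHS]big_seq; apply: ler_sum => c' c'xs.
    by have /andP[] := bF x c' x1 (mem_rem c'xs).
  rewrite [leRHS]big_const_seq count_predT iter_addr_0 size_rem // -/n => h.
  have -> : (M - (M - m) / (4 * n%:R)) * n%:R = M * n%:R - (M - m) / 4.
    by field; rewrite gt_eqF.
  move: h; rewrite -{2}(prednK n0) -mulr_natr mulrSr; lra.
- rewrite m1 /=.
  have : (M - m) / (4 * n%:R) <= M - m.
    rewrite ler_pdivrMr ?mulr_gt0 // ler_peMr ?subr_ge0 //.
    by have : 1 <= n%:R :> R by [rewrite ler1n]; lra.
  lra.
- have : 0 <= (M - m) / (4 * n%:R) by rewrite divr_ge0 ?subr_ge0 // mulr_ge0 // ltW.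
  lra.
- have : e <= (4 * n%:R)^-1.
    by rewrite eE lef_pV2 ?posrE ?mulr_gt0 ?ltr0n // ler_pM2l // ler_nat.
  move=> nn; rewrite /q; have : 0 <= M - m by rewrite subr_ge0.
  nra.
Qed.

(** The bound M0 is kept throughout, so the same q serves every step and the gap decays
    geometrically until it is below D. *)
Lemma width_gap (R : realType) (d : nat) (D : R) : 0 < D ->
  exists (s : seq 'rV[R]_d) m M, [/\ width_bounds s m M, 1 <= m <= M & M - m < D].
Proof.
move=> D0; pose M0 : R := (d.+1)%:R.
have M00 : 0 < M0 by rewrite ltr0n.
have [q /andP[q0 q1] step] := @width_gap_step R d M0 D M00 D0.
have iter n : exists (s : seq 'rV[R]_d) m M,
    [/\ width_bounds s m M, 1 <= m <= M, M <= M0 &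
      M - m < D \/ M - m <= q ^+ n * M0].
  elim: n => [|n [s [m [M [b mM MM0 [MmD|MmD]]]]]].
  (* The coordinate vectors give the l1 norm, which lies between 1 and d on the Euclidean unit
     sphere. *)
  - exists [seq delta_mx 0 i | i <- enum 'I_d], 1, M0; split => //.
    + move=> x x1; rewrite /width big_map big_enum /=.
      have -> : \sum_(i < d) `|dot x (delta_mx 0 i)| = \sum_(i < d) `|x 0 i|.
        apply: eq_bigr => i _; rewrite /dot (bigD1 i) //= mxE !eqxx mulr1.
        by rewrite big1 ?addr0 // => j ji; rewrite mxE (negbTE ji) andbF mulr0.
      have xi i : `|x 0 i| <= 1 by rewrite -x1 coord_le_enorm.
      apply/andP; split.
        rewrite -(expr1n R 2) -{1}x1 sqr_enorm; apply: ler_sum => i _.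
        rewrite -expr2 -real_normK ?num_real // expr2.
        by have := xi i; have := normr_ge0 (x 0 i); nra.
      apply: (@le_trans _ _ (\sum_(i < d) 1)); first exact: ler_sum.
      by rewrite sumr_const card_ord ler_nat.
    + by rewrite lexx ler1n.
    + by right; rewrite expr0 mul1r; lra.
  - by exists s, m, M; split => //; left.
  - have [MmD'|MmD'] := ltP (M - m) D.
      by exists s, m, M; split => //; left.
    have [s' [m' [M' [b' mM' MM0' g']]]] := step s m M b mM MM0 MmD'.
    exists s', m', M'; split => //; right; apply: le_trans g' _.
    by rewrite exprS -mulrA ler_wpM2l.
have [n qn] : exists n, q ^+ n * M0 < D.
  have qD : (fun n => q ^+ n) @ \oo --> (0 : R).
    by apply: cvg_expr; rewrite ger0_norm.
  have /cvgrPdist_lt /(_ (D / M0) (divr_gt0 D0 M00)) [n _ /(_ n (leqnn n))] := qD.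
  rewrite sub0r normrN ger0_norm ?exprn_ge0 // ltr_pdivlMr // => h.
  by exists n.
have [s [m [M [b mM _ [?|?]]]]] := iter n; exists s, m, M; split => //.
exact: le_lt_trans qn.
Qed.

(** Scaling by 1/M makes the support function at most that of the ball; since m >= 1 and M - m <
    eta, the factor 1 + eta brings it above that of the ball. The first inclusion tests a point z in
    its own direction, the second separates a missing point. *)
Lemma ball_zonotope_approx (R : realType) (d : nat) (eta : R) : 0 < eta ->
  exists s : seq 'rV[R]_d, zonotope s `<=` @unit_ball R d /\
    @unit_ball R d `<=` zonotope [seq (1 + eta) *: z | z <- s].
Proof.
move=> e0; have [s [m [M [b /andP[m1 mM] g]]]] := @width_gap R d eta e0.
have M0 : 0 < M by lra.
exists [seq M^-1 *: z | z <- s]; split => [z zs|x x1].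
  have := zonotope_support z zs; rewrite width_scale ?invr_ge0 -?sqr_enorm; last lra.
  have /andP[_ h] := width_bounds_scale z b.
  rewrite ler_pdivlMl // => h'.
  rewrite /unit_ball /= leNgt; apply/negP => z1.
  have zp : 0 < enorm z by lra.
  have : M * enorm z ^+ 2 <= M * enorm z := le_trans h' h.
  by rewrite expr2 ler_pM2l // ger_pMr //; lra.
apply: contrapT => xn.
have [|y yk] := convex_body_separation (zonotope_body _) _ xn.
  have [z zs _] := zonotope_attained [seq (1 + eta) *: z | z <- [seq M^-1 *: z | z <- s]] 0.
  by exists z.
have [k ks ky] := zonotope_attained [seq (1 + eta) *: z | z <- [seq M^-1 *: z | z <- s]] y.
have := yk k ks; rewrite ky !width_scale ?invr_ge0; try lra.
have /andP[h _] := width_bounds_scale y b.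
have h1 := dot_le_enorm y x.
have h2 : enorm y * enorm x <= enorm y by rewrite ler_piMr ?enorm_ge0.
have h3 : enorm y <= (1 + eta) * (M^-1 * width s y).
  rewrite mulrA -ler_pdivrMl ?mulr_gt0 ?invr_gt0 //; last lra.
  rewrite invfM invrK (le_trans _ h) // ler_wpM2r ?enorm_ge0 //.
  by rewrite mulrC ler_pdivrMr; [nra|lra].
by move=> h4; lra.
Qed.

(** * Intrinsic volumes *)

(** Coefficients become fixed linear combinations of finitely many values, so for polynomials of
    bounded degree pointwise convergence implies convergence of the coefficients. *)
Lemma interpolation (R : realType) (n : nat) :
  exists l : nat -> {poly R}, forall q : {poly R}, (size q <= n.+1)%N ->
    q = \sum_(i < n.+1) q.[i%:R] *: l i.
Proof.
pose x (i : nat) : R := i%:R.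
have xI : injective x by move=> i j /eqP; rewrite eqr_nat => /eqP.
exists (fun i => tnth (lagrange n.+1 x) (inord i) : {poly R}) => q qn.
rewrite {1}(lagrange_gen (n := n.+1) isT xI qn); apply: eq_bigr => i _.
by rewrite mul_polyC inord_val.
Qed.

Lemma sum_pow_unique (R : realType) (n : nat) (a b : nat -> R) :
  (forall e : R, 0 < e -> \sum_(k < n) a k * e ^+ k = \sum_(k < n) b k * e ^+ k) ->
  forall k, (k < n)%N -> a k = b k.
Proof.
move=> ab k kn; pose p := \poly_(k < n) (a k - b k).
suff p0 : p = 0.
  have /(congr1 (fun q : {poly R} => q`_k)) := p0.
  by rewrite coef_poly kn coef0 => /eqP; rewrite subr_eq0 => /eqP.
apply: (@roots_geq_poly_eq0 _ p [seq (i.+1)%:R | i <- iota 0 n]).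
- apply/allP => _ /mapP[i _ ->]; rewrite rootE horner_poly.
  under eq_bigr do rewrite mulrBl.
  by rewrite big_split /= sumrN ab ?subrr // ltr0n.
- rewrite map_inj_uniq ?iota_uniq // => i j /eqP.
  by rewrite eqr_nat => /eqP[].
- by rewrite size_map size_iota size_poly.
Qed.

Lemma cvg_sum_seq (R : realType) (I : finType) (u : I -> nat -> R) (l : I -> R) :
  (forall i, u i @ \oo --> l i) ->
  (fun n => \sum_i u i n) @ \oo --> \sum_i l i.
Proof.
move=> ul; rewrite (_ : (fun n => _) = \sum_i u i); last first.
  by apply/funext => n; rewrite fct_sumE.
apply: (big_ind2 (fun (f : nat -> R) (y : R) => f @ \oo --> y)) => //.
- exact: cvg_cst.
- by move=> f y g z fy gz; exact: cvgD.
Qed.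

(** For zonotopes Z_n with Z_n inside B inside (1 + eta_n) Z_n, the polynomial g_n = vol (K + eps
    Z_n) satisfies g_n <= f <= (1 + eta_n)^d g_n, where f is the parallel volume. Hence g_n tends to
    f at each eps; by interpolation the coefficients converge too, and their signs and order survive
    in the limit. *)
Lemma parallel_volume_poly (R : realType) (d : nat) :
  exists c : set 'rV[R]_d -> nat -> R, forall K, convex_body K ->
    [/\ forall k, 0 <= c K k,
        forall K', convex_body K' -> K `<=` K' -> forall k, c K k <= c K' k
      & forall eps, 0 <= eps ->
          volr (parallel_body K eps) = \sum_(k < d.+1) c K k * eps ^+ k].
Proof.
pose eta (n : nat) : R := n.+1%:R^-1.
have eta0 n : 0 < eta n by rewrite invr_gt0.
have /choice[s sP] n := @ball_zonotope_approx R d (eta n) (eta0 n).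
have /choice[c cP] n := @volr_zonotope_poly R d (s n).
pose f (K : set 'rV[R]_d) eps := volr (parallel_body K eps).
pose g n K eps := \sum_(k < d.+1) c n K k * eps ^+ k.
have scaleS (s' : seq 'rV[R]_d) a : [set a *: x | x in zonotope s'] =
    zonotope [seq a *: z | z <- s'].
  have := lin_zonotope (a%:M) s'; rewrite /lin.
  rewrite (_ : (fun x => x *m a%:M) = (fun x => a *: x)) => [->|]; last first.
    by apply/funext => x; rewrite mul_mx_scalar.
  by congr zonotope; apply: eq_map => x; rewrite mul_mx_scalar.
have gf n K eps : convex_body K -> 0 <= eps -> g n K eps <= f K eps.
  move=> bK e0; have [_ _ cE] := cP n K bK; rewrite /g -cE //.
  apply: le_volr; first exact: minksum_body (zonotope_body _).
    exact: parallel_body_body.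
  rewrite parallel_bodyE -scaleS; apply: minksum_subset => //.
  by apply: image_subset; have [] := sP n.
have fg n K eps : convex_body K -> 0 <= eps -> f K eps <= (1 + eta n) ^+ d * g n K eps.
  move=> bK e0; have [c0 _ cE] := cP n K bK.
  have e1 : 1 <= 1 + eta n by rewrite lerDl ltW.
  have ee : 0 <= eps * (1 + eta n) by rewrite mulr_ge0 // (le_trans ler01).
  (* A polynomial of degree at most d with nonnegative coefficients grows at most by the factor c^d
     when its nonnegative argument is multiplied by c >= 1. *)
  apply: (@le_trans _ _ (g n K (eps * (1 + eta n)))); last first.
    rewrite /g mulr_sumr; apply: ler_sum => k _.
    have -> : c n K k * (eps * (1 + eta n)) ^+ k =
        (1 + eta n) ^+ k * (c n K k * eps ^+ k) by rewrite exprMn; ring.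
    apply: ler_pM => //; first by rewrite exprn_ge0 // (le_trans ler01).
      by rewrite mulr_ge0 ?exprn_ge0.
    by apply: ler_weXn2l => //; rewrite -ltnS.
  rewrite /g -cE //; apply: le_volr; first exact: parallel_body_body.
    exact: minksum_body (zonotope_body _).
  rewrite parallel_bodyE.
  have -> : [seq (eps * (1 + eta n)) *: z | z <- s n] =
      [seq eps *: z | z <- [seq (1 + eta n) *: z | z <- s n]].
    by rewrite -map_comp; apply: eq_map => z /=; rewrite scalerA.
  rewrite -scaleS; apply: minksum_subset => //.
  by apply: image_subset; have [] := sP n.
have gcvg K eps : convex_body K -> 0 <= eps -> (fun n => g n K eps) @ \oo --> f K eps.
  move=> bK e0; apply: (@squeeze_cvgr _ _ _ _ (fun n => ((1 + eta n) ^+ d)^-1 * f K eps)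
      (fun=> f K eps)).
  - near=> n; rewrite gf // andbT ler_pdivrMl ?fg // exprn_gt0 //.
    by rewrite (lt_trans ltr01) // ltrDl.
  - rewrite -[X in _ --> X]mul1r; apply: cvgM; last exact: cvg_cst.
    rewrite -[X in _ --> X]invr1; apply: cvgV; first by rewrite oner_neq0.
    rewrite -[X in _ --> X](expr1n R d).
    have eta1 : (fun n => 1 + eta n) @ \oo --> (1 : R).
      rewrite -[X in _ --> X]addr0; apply: cvgD; first exact: cvg_cst.
      exact: cvg_harmonic.
    exact: (cvg_comp _ _ eta1 (@exprn_continuous R d 1)).
  - exact: cvg_cst.
have [l lP] := interpolation R d.
pose C (K : set 'rV[R]_d) k := \sum_(i < d.+1) f K i%:R * (l i)`_k.
have Ccvg K k : convex_body K -> (k < d.+1)%N ->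
    (fun n => c n K k) @ \oo --> C K k.
  move=> bK kd.
  rewrite (_ : (fun n => _) = (fun n => \sum_(i < d.+1) g n K i%:R * (l i)`_k)).
    apply: cvg_sum_seq => i; apply: cvgM; last exact: cvg_cst.
    exact: gcvg.
  apply/funext => n; pose q := \poly_(k < d.+1) c n K k.
  have -> : c n K k = q`_k by rewrite coef_poly kd.
  rewrite {1}(lP q (size_poly _ _)) coef_sum; apply: eq_bigr => i _.
  by rewrite coefZ horner_poly.
exists (fun K k => if (k < d.+1)%N then C K k else 0) => K bK; split.
- move=> k; case: ifPn => // kd.
  apply: (ler_cvg_to (cvg_cst (0 : R)) (Ccvg K k bK kd)).
  by near=> n; have [c0 _ _] := cP n K bK.
- move=> K' bK' KK' k; case: ifPn => // kd.
  apply: (ler_cvg_to (Ccvg K k bK kd) (Ccvg K' k bK' kd)).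
  by near=> n; have [_ cm _] := cP n K bK; exact: cm.
- move=> eps e0; have := gcvg K eps bK e0.
  move=> /(cvg_lim (@Rhausdorff R)); rewrite /f => <-; apply: cvg_lim => //.
  rewrite /g; apply: cvg_sum_seq => k; apply: cvgM; last exact: cvg_cst.
  by rewrite ltn_ord; exact: Ccvg.
Unshelve. all: by end_near. Qed.

Lemma ball_volume_gt0 (R : realType) (m : nat) : 0 < ball_volume R m.
Proof. exact: volr_ball_gt0. Qed.

(** The choice made by [get] is meaningful once some sequence satisfies the Steiner formula; the
    coefficients of the parallel volume, reversed and divided by the ball volumes, form one. *)
Lemma intrinsic_volume_spec (R : realType) (d : nat) (K : set 'rV[R]_d) :
  convex_body K ->
  (forall j, (d < j)%N -> intrinsic_volume j K = 0) /\
  forall eps, 0 <= eps -> volr (parallel_body K eps) =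
    \sum_(j < d.+1) ball_volume R (d - j) * intrinsic_volume j K * eps ^+ (d - j).
Proof.
move=> bK; have [c cP] := parallel_volume_poly R d.
have [_ _ cE] := cP K bK.
pose P := [set V : nat -> R | (forall j, (d < j)%N -> V j = 0) /\
    forall eps : R, 0 <= eps -> vol (parallel_body K eps) =
      (\sum_(j < d.+1) ball_volume R (d - j) * V j * eps ^+ (d - j))%:E].
have [h1 h2] : P (get P).
  apply: getPex.
  exists (fun j => if (d < j)%N then 0 else c K (d - j)%N / ball_volume R (d - j)).
  split=> [j ->//|eps e0]; rewrite volrE; last exact: parallel_body_body.
  congr (_%:E); rewrite cE // (reindex_inj rev_ord_inj); apply: eq_bigr => j _ /=.
  rewrite subSS ltnNge -ltnS ltn_ord /= [ball_volume _ _ * _]mulrC divfK //.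
  by rewrite gt_eqF ?ball_volume_gt0.
split => // eps e0; rewrite /volr h2 //.
Qed.

Lemma intrinsic_volume_coef (R : realType) (d : nat) (K : set 'rV[R]_d)
    (c : nat -> R) : convex_body K ->
  (forall eps, 0 < eps ->
    volr (parallel_body K eps) = \sum_(k < d.+1) c k * eps ^+ k) ->
  forall j, (j <= d)%N ->
    intrinsic_volume j K = c (d - j)%N / ball_volume R (d - j).
Proof.
move=> bK cE j jd; have [_ VE] := intrinsic_volume_spec bK.
have h : forall e : R, 0 < e ->
    \sum_(k < d.+1) (ball_volume R k * intrinsic_volume (d - k) K) * e ^+ k =
    \sum_(k < d.+1) c k * e ^+ k.
  move=> e e0; rewrite -cE // VE ?ltW // (reindex_inj rev_ord_inj).
  apply: eq_bigr => k _ /=.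
  by rewrite subSS subKn // -ltnS.
have dj : (d - j < d.+1)%N by rewrite ltnS leq_subr.
have := @sum_pow_unique _ _ (fun k => ball_volume R k * intrinsic_volume (d - k) K)
  c h _ dj.
rewrite subKn // => <-; rewrite mulrC mulKf //.
by rewrite gt_eqF ?ball_volume_gt0.
Qed.

(** The means of computing intrinsic volumes below: it is enough to exhibit a Steiner expansion for
    positive eps, since a polynomial is determined by its values there. *)
Lemma intrinsic_volume_unique (R : realType) (d : nat) (K : set 'rV[R]_d)
    (W : nat -> R) : convex_body K ->
  (forall eps, 0 < eps -> volr (parallel_body K eps) =
    \sum_(j < d.+1) ball_volume R (d - j) * W j * eps ^+ (d - j)) ->
  forall j, (j <= d)%N -> intrinsic_volume j K = W j.
Proof.
move=> bK WE j jd.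
rewrite (@intrinsic_volume_coef _ _ _
  (fun k => ball_volume R k * W (d - k)%N) bK _ j jd).
  by rewrite subKn // mulrC mulKf // gt_eqF ?ball_volume_gt0.
move=> e e0; rewrite WE // (reindex_inj rev_ord_inj).
by apply: eq_bigr => k _ /=; rewrite subSS subKn // -ltnS.
Qed.

Lemma intrinsic_volume_ge0 (R : realType) (d : nat) (K : set 'rV[R]_d) j :
  convex_body K -> 0 <= intrinsic_volume j K.
Proof.
move=> bK; have [jd|jd] := leqP j d; last by rewrite (intrinsic_volume_spec bK).1.
have [c cP] := parallel_volume_poly R d; have [c0 _ cE] := cP K bK.
rewrite (intrinsic_volume_coef bK (fun e e0 => cE e (ltW e0)) jd).
by rewrite divr_ge0 // ltW // ball_volume_gt0.
Qed.

Lemma le_intrinsic_volume (R : realType) (d : nat) (K L : set 'rV[R]_d) j :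
  convex_body K -> convex_body L -> K `<=` L ->
  intrinsic_volume j K <= intrinsic_volume j L.
Proof.
move=> bK bL KL; have [jd|jd] := leqP j d; last first.
  by rewrite (intrinsic_volume_spec bK).1 // (intrinsic_volume_spec bL).1.
have [c cP] := parallel_volume_poly R d; have [c0 cm cE] := cP K bK.
have [_ _ cE'] := cP L bL.
rewrite (intrinsic_volume_coef bK (fun e e0 => cE e (ltW e0)) jd).
rewrite (intrinsic_volume_coef bL (fun e e0 => cE' e (ltW e0)) jd).
by rewrite ler_pM2r ?invr_gt0 ?ball_volume_gt0 //; exact: cm.
Qed.

Lemma eq_intrinsic_volume (R : realType) (d : nat) (K L : set 'rV[R]_d) j :
  convex_body K -> convex_body L ->
  (forall eps, 0 < eps -> volr (parallel_body K eps) = volr (parallel_body L eps)) ->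
  intrinsic_volume j K = intrinsic_volume j L.
Proof.
move=> bK bL KL; have [jd|jd] := leqP j d; last first.
  by rewrite (intrinsic_volume_spec bK).1 // (intrinsic_volume_spec bL).1.
apply: intrinsic_volume_unique => // eps e0.
by rewrite KL // (intrinsic_volume_spec bL).2 // ltW.
Qed.

Lemma intrinsic_volume_set0 (R : realType) (d j : nat) :
  intrinsic_volume j (@set0 'rV[R]_d) = 0.
Proof.
have b0 := @set0_body R d.
have [jd|jd] := leqP j d; last by rewrite (intrinsic_volume_spec b0).1.
apply: (@intrinsic_volume_unique _ _ _ (fun=> 0)) => // eps e0.
rewrite (_ : parallel_body _ _ = set0) ?volr_set0; last first.
  by apply/seteqP; split => // x [y [b []]].
by rewrite big1 // => i _; rewrite mulr0 mul0r.
Qed.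

(** Taking parallel bodies turns the two parts and their section into two sets and their
    intersection, with the parallel body of S as union. The modularity of the measure then passes to
    the coefficients. *)
Lemma intrinsic_volume_modular (R : realType) (d : nat) (S : set 'rV[R]_d) p u j :
  convex_body S ->
  intrinsic_volume j S + intrinsic_volume j (section S p u) =
  intrinsic_volume j (upper_part S p u) + intrinsic_volume j (lower_part S p u).
Proof.
move=> bS; have bU := upper_body p u bS; have bL := lower_body p u bS.
have bK := section_body p u bS.
have [jd|jd] := leqP j d; last first.
  by rewrite !(intrinsic_volume_spec _).1 // addr0.
suff -> : intrinsic_volume j S = intrinsic_volume j (upper_part S p u) +
    intrinsic_volume j (lower_part S p u) - intrinsic_volume j (section S p u).
  by rewrite subrK.
apply: (@intrinsic_volume_unique _ _ _ (fun j => intrinsic_volume j (upper_part S p u) +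
  intrinsic_volume j (lower_part S p u) - intrinsic_volume j (section S p u))) => //.
move=> eps e0; have e0' := ltW e0.
have UL : parallel_body S eps = parallel_body (upper_part S p u) eps `|`
    parallel_body (lower_part S p u) eps.
  apply/seteqP; split => z.
    move=> [x [b [Sx Bb ->]]].
    by have [px|xp] := lerP p (dot u x); [left|right]; exists x, b; split => //;
      split => //; exact: ltW.
  by move=> [] [x [b [[Sx _] Bb ->]]]; exists x, b.
have KE : parallel_body (section S p u) eps = parallel_body (upper_part S p u) eps `&`
    parallel_body (lower_part S p u) eps.
  apply/seteqP; split => z.
    by move=> [x [b [[Sx px] Bb ->]]]; split; exists x, b; split => //; split => //;
      rewrite px.
  move=> [[x [b [[Sx px] Bb zE]]] [y [b' [[Sy yp] Bb' zE']]]].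
  (* The segment from x to y meets the hyperplane. Combining b and b' with the same t yields the
     same point z, so z is within eps of the section. *)
  have [t [t01 tp]] : exists t, 0 <= t <= 1 /\
      dot u ((1 - t) *: x + t *: y) = p.
    have [xy|xy] := eqVneq (dot u x) (dot u y).
      by exists 0; rewrite subr0 scale1r scale0r addr0; split; lra.
    have xy' : 0 < dot u x - dot u y.
      by rewrite subr_gt0 lt_neqAle eq_sym xy (le_trans yp px).
    exists ((dot u x - p) / (dot u x - dot u y)); split; last first.
      by rewrite !dotE; field; rewrite gt_eqF.
    apply/andP; split; first by rewrite divr_ge0 ?subr_ge0 // ltW // -subr_gt0.
    by rewrite ler_pdivrMr // mul1r lerB.
  have [_ xS] := bS; have [_ xB] := @unit_ball_body R d.
  exists ((1 - t) *: x + t *: y), ((1 - t) *: b + t *: b'); split.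
  - by split => //; apply: xS.
  - exact: xB.
  - rewrite scalerDr !scalerA ![eps * _]mulrC -!scalerA addrACA -!scalerDr.
    by rewrite -zE -zE' -scalerDl subrK scale1r.
have vE := volr_modular (parallel_body_body eps bU) (parallel_body_body eps bL).
rewrite -UL -KE in vE.
have {}vE := vE (parallel_body_body eps bS) (parallel_body_body eps bK).
have -> : volr (parallel_body S eps) = volr (parallel_body (upper_part S p u) eps) +
    volr (parallel_body (lower_part S p u) eps) -
    volr (parallel_body (section S p u) eps) by lra.
rewrite !(intrinsic_volume_spec _).2 // -big_split -sumrB; apply: eq_bigr => i _ /=.
by ring.
Qed.

(** * Intrinsic volumes under translations, isometries and dilations *)

Lemma parallel_body_translate (R : realType) (d : nat) (c : 'rV[R]_d)
    (K : set 'rV[R]_d) eps :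
  parallel_body [set c + x | x in K] eps = [set c + x | x in parallel_body K eps].
Proof.
apply/seteqP; split => z.
  move=> [_ [b [[x Kx <-] Bb ->]]]; exists (x + eps *: b); last by rewrite addrA.
  by exists x, b.
move=> [_ [x [b [Kx Bb ->]]] <-]; exists (c + x), b; split; rewrite ?addrA //.
by exists x.
Qed.

Lemma intrinsic_volume_translate (R : realType) (d : nat) (c : 'rV[R]_d)
    (K : set 'rV[R]_d) j : convex_body K ->
  intrinsic_volume j [set c + x | x in K] = intrinsic_volume j K.
Proof.
move=> bK; apply: eq_intrinsic_volume => //; first exact: translate_body.
move=> eps _; rewrite parallel_body_translate volr_translate //.
exact: parallel_body_body.
Qed.

Lemma lin_unit_ball (R : realType) (d : nat) (M : 'M[R]_d) :
  orthogonal_mx M -> lin M (@unit_ball R d) = @unit_ball R d.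
Proof.
move=> oM; have oM' : M^T *m M = 1%:M by exact: mulmx1C.
apply/seteqP; split => x; rewrite /unit_ball /=.
  by move=> [y y1 <-]; rewrite /= orthogonal_enorm.
move=> x1; exists (x *m M^T); last by rewrite -mulmxA oM' mulmx1.
by rewrite /= orthogonal_enorm // /orthogonal_mx trmxK.
Qed.

Lemma lin_scale (R : realType) (m n : nat) (M : 'M[R]_(m, n)) a (A : set 'rV[R]_m) :
  lin M [set a *: x | x in A] = [set a *: x | x in lin M A].
Proof.
apply/seteqP; split => z.
  by move=> [_ [x Ax <-] <-]; exists (x *m M); [exists x|rewrite scalemxAl].
by move=> [_ [x Ax <-] <-]; exists (a *: x); [exists x|rewrite scalemxAl].
Qed.

Lemma intrinsic_volume_orthogonal (R : realType) (d : nat) (M : 'M[R]_d)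
    (K : set 'rV[R]_d) j : orthogonal_mx M -> convex_body K ->
  intrinsic_volume j (lin M K) = intrinsic_volume j K.
Proof.
move=> oM bK; apply: eq_intrinsic_volume => //; first exact: lin_body.
move=> eps _; have -> : parallel_body (lin M K) eps = lin M (parallel_body K eps).
  by rewrite !parallel_bodyE lin_minksum lin_scale lin_unit_ball.
by rewrite /lin volr_orthogonal //; exact: parallel_body_body.
Qed.

Lemma intrinsic_volume_scale (R : realType) (d : nat) a (K : set 'rV[R]_d) j :
  0 < a -> convex_body K -> (j <= d)%N ->
  intrinsic_volume j [set a *: x | x in K] = a ^+ j * intrinsic_volume j K.
Proof.
move=> a0 bK jd; apply: (@intrinsic_volume_unique _ _ _
  (fun j => a ^+ j * intrinsic_volume j K)) => //; first exact: scale_body.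
move=> eps e0.
have -> : parallel_body [set a *: x | x in K] eps =
    [set a *: x | x in parallel_body K (eps / a)].
  apply/seteqP; split => z.
    move=> [_ [b [[x Kx <-] Bb ->]]]; exists (x + (eps / a) *: b).
      by exists x, b.
    by rewrite scalerDr scalerA mulrC divfK // gt_eqF.
  move=> [_ [x [b [Kx Bb ->]]] <-]; exists (a *: x), b; split => //.
    by exists x.
  by rewrite scalerDr scalerA [a * _]mulrC divfK // gt_eqF.
rewrite volr_scale //; last exact: parallel_body_body.
rewrite (intrinsic_volume_spec bK).2; last by rewrite divr_ge0 ?ltW.
rewrite mulr_sumr; apply: eq_bigr => i _.
have id : (i <= d)%N by rewrite -ltnS.
rewrite expr_div_n -{1}(subnKC id) exprD; field.
by rewrite expf_neq0 // gt_eqF.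
Qed.

Lemma intrinsic_volume_set1 (R : realType) (d : nat) (c : 'rV[R]_d) j :
  intrinsic_volume j [set c] = (j == 0%N)%:R.
Proof.
have b1 := set1_body c.
have [jd|jd] := leqP j d; last first.
  by rewrite (intrinsic_volume_spec b1).1 //; case: j jd.
apply: (@intrinsic_volume_unique _ _ _ (fun j => (j == 0%N)%:R)) => // eps e0.
have -> : parallel_body [set c] eps =
    [set c + x | x in [set eps *: x | x in @unit_ball R d]].
  apply/seteqP; split => z.
    by move=> [_ [b [-> Bb ->]]]; exists (eps *: b) => //; exists b.
  by move=> [_ [b Bb <-] <-]; exists c, b.
rewrite volr_translate; last exact/scale_body/unit_ball_body.
rewrite volr_scale //; last exact: unit_ball_body.
rewrite big_ord_recl big1 => [|i _]; last by rewrite mulr0 mul0r.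
by rewrite addr0 subn0 eqxx mulr1 mulrC.
Qed.

(** The parallel body of the ball is the ball of radius 1 + eps, and the binomial expansion of (1 +
    eps)^d gives the explicit value. *)
Lemma intrinsic_volume_ball_gt0 (R : realType) (d j : nat) : (j <= d)%N ->
  0 < intrinsic_volume j (@unit_ball R d).
Proof.
move=> jd; have bB := @unit_ball_body R d.
rewrite (@intrinsic_volume_unique _ _ _ (fun j =>
  'C(d, j)%:R * ball_volume R d / ball_volume R (d - j)) bB _ j jd).
  by rewrite divr_gt0 ?mulr_gt0 ?ball_volume_gt0 // ltr0n bin_gt0.
move=> eps e0.
have -> : parallel_body (@unit_ball R d) eps =
    [set (1 + eps) *: x | x in @unit_ball R d].
  apply/seteqP; split => z.
    move=> [x [b [Bx Bb ->]]]; exists ((1 + eps)^-1 *: (x + eps *: b)); last first.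
      by rewrite scalerA mulfV ?scale1r // gt_eqF //; lra.
    rewrite /unit_ball /= enormZ ger0_norm ?invr_ge0; last lra.
    rewrite ler_pdivrMl ?mulr1; last lra.
    apply: le_trans (enormD _ _) _; rewrite enormZ (gtr0_norm e0).
    by rewrite lerD // ler_piMr // ltW.
  by move=> [x Bx <-]; exists x, x; rewrite scalerDl scale1r.
rewrite volr_scale //; last lra.
rewrite [1 + _]addrC exprDn mulr_suml; apply: eq_bigr => i _.
rewrite expr1n mulr1; set k := ball_volume R d; rewrite -[volr _]/k.
have := ball_volume_gt0 R (d - i) => /lt0r_neq0 kn.
by rewrite -mulr_natl; field.
Qed.

(** * Cylinders and cones *)

Lemma parallel_bodyP (R : realType) (d : nat) (K : set 'rV[R]_d) r y : 0 <= r ->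
  parallel_body K r y <-> exists2 k, K k & enorm (y - k) <= r.
Proof.
move=> r0; split.
  move=> [k [b [Kk Bb ->]]]; exists k => //.
  by rewrite addrC addKr enormZ (ger0_norm r0) ler_piMr.
move=> [k Kk yk]; have [r00|rn] := eqVneq r 0.
  exists k, 0; split; rewrite /unit_ball /= ?enorm0 // scaler0 addr0.
  apply/eqP; rewrite -subr_eq0; apply/eqP/enorm0_eq0/eqP.
  by rewrite eq_le enorm_ge0 andbT -[leRHS]r00.
have rp : 0 < r by rewrite lt_def rn.
exists k, (r^-1 *: (y - k)); split => //; last first.
  by rewrite scalerA mulfV // scale1r addrC subrK.
by rewrite /unit_ball /= enormZ ger0_norm ?invr_ge0 // ler_pdivrMl // mulr1.
Qed.

Definition embed (R : realType) (d : nat) (K : set 'rV[R]_d) : set 'rV[R]_d.+1 :=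
  [set consrV (0, y) | y in K].

Lemma embed_body (R : realType) (d : nat) (K : set 'rV[R]_d) :
  convex_body K -> convex_body (embed K).
Proof.
move=> bK.
pose E : 'M[R]_(d, 1 + d) := row_mx 0 1%:M.
have EE (y : 'rV[R]_d) : consrV (0, y) = y *m E.
  rewrite /E /consrV [RHS](@mul_mx_row R 1 d 1 d) mulmx0 mulmx1 /=.
  by have -> : (0%:M : 'M[R]_1) = 0 by apply/matrixP => i j; rewrite !mxE mul0rn.
rewrite (_ : embed K = lin E K); first exact: lin_body.
by apply/seteqP; split => z [y Ky <-]; exists y; rewrite // EE.
Qed.

Lemma measurable_vol_slice (R : realType) (d : nat) (X : set 'rV[R]_d.+1) :
  convex_body X ->
  measurable_fun setT
    (fun x : measurableTypeR R => vol [set y : 'rV[R]_d | X (consrV (x, y))]).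
Proof.
move=> bX; have [mu vol_mu] := vol_measure R d.
have mX : measurable ([set xy | X (consrV xy)] : set (measurableTypeR R * mrV R d)).
  apply: (measurable_preim (@measurable_consrV R d)).
  exact: convex_body_measurable.
have := measurable_fun_xsection mu mX.
congr (measurable_fun _ _); apply/funext => x /=; rewrite vol_mu; congr (mu _).
by apply/seteqP; split => y; rewrite /xsection /= inE.
Qed.

(** By Pythagoras, the slice at height s is a parallel body of K with the reduced radius. *)
Lemma vol_slice_parallel_body (R : realType) (d : nat) (K : set 'rV[R]_d) eps s :
  convex_body K -> 0 <= eps ->
  vol [set y : 'rV[R]_d | parallel_body (embed K) eps (consrV (s, y))] =
  (if `|s| <= eps then volr (parallel_body K (Num.sqrt (eps ^+ 2 - s ^+ 2))) else 0)%:E.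
Proof.
move=> bK e0.
have key (y k : 'rV[R]_d) : (enorm (consrV (s, y) - consrV (0, k)) <= eps) =
    (s ^+ 2 + dot (y - k) (y - k) <= eps ^+ 2).
  rewrite -ler_sqr ?nnegrE ?enorm_ge0 // sqr_enorm.
  have -> : consrV (s, y) - consrV (0, k) = consrV (s, y - k).
    by rewrite -scaleN1r consrVZ consrVD mulr0 addr0 scaleN1r.
  by rewrite dot_consrV -expr2.
case: ifPn => se.
  have s2 : 0 <= eps ^+ 2 - s ^+ 2.
    by rewrite subr_ge0 -(real_normK (num_real s)) ler_sqr ?nnegrE.
  rewrite -volrE; last exact: parallel_body_body.
  congr (vol _); apply/seteqP; split => y.
    move=> /(parallel_bodyP _ _ e0)[_ [k Kk <-]]; rewrite key => h.
    apply/parallel_bodyP; rewrite ?sqrtr_ge0 //; exists k => //.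
    rewrite -ler_sqr ?nnegrE ?enorm_ge0 ?sqrtr_ge0 // sqr_enorm sqr_sqrtr //; lra.
  move=> /(parallel_bodyP _ _ (sqrtr_ge0 _))[k Kk].
  rewrite -ler_sqr ?nnegrE ?enorm_ge0 ?sqrtr_ge0 // sqr_enorm sqr_sqrtr // => h.
  apply/parallel_bodyP => //; exists (consrV (0, k)); first by exists k.
  by rewrite key; lra.
rewrite (_ : [set y | _] = set0); last first.
  apply/seteqP; split => y //= /(parallel_bodyP _ _ e0)[_ [k Kk <-]]; rewrite key => h.
  move: se; rewrite -ltNge -ltr_sqr ?nnegrE // real_normK ?num_real //.
  by have := dot_ge0 (y - k); lra.
by have [mu ->] := vol_measure R d; rewrite measure0.
Qed.

Lemma volr_parallel_point (R : realType) (d : nat) (c : 'rV[R]_d) r : 0 <= r ->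
  volr (parallel_body [set c] r) = ball_volume R d * r ^+ d.
Proof.
move=> r0; rewrite (intrinsic_volume_spec (set1_body c)).2 // big_ord_recl.
rewrite big1 => [|i _]; first by rewrite intrinsic_volume_set1 eqxx mulr1 addr0 subn0.
by rewrite intrinsic_volume_set1 mulr0 mul0r.
Qed.

(** Intrinsic volumes do not depend on the ambient dimension: integrating the Steiner formula of K
    over the slices must replace each [ball_volume R m * eps ^+ m] by the same expression for
    [m.+1]. *)
Lemma intrinsic_volume_embed (R : realType) (d : nat) (K : set 'rV[R]_d) j :
  convex_body K -> (j <= d)%N ->
  intrinsic_volume j (embed K) = intrinsic_volume j K.
Proof.
move=> bK jd; have bE := embed_body bK.
rewrite (@intrinsic_volume_unique _ _ _
  (fun j => if (j <= d)%N then intrinsic_volume j K else 0) bE _ j) ?jd //; last exact: leqW.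
move=> eps e0; have e0' := ltW e0.
pose r s := Num.sqrt (eps ^+ 2 - s ^+ 2).
pose phi (m : nat) (s : R) : \bar R :=
  (if `|s| <= eps then ball_volume R m * r s ^+ m else 0)%:E.
have phi0 m s : (0 <= phi m s)%E.
  rewrite /phi lee_fin; case: ifPn => // _.
  by rewrite mulr_ge0 ?exprn_ge0 ?sqrtr_ge0 // ltW // ball_volume_gt0.
have phiE m : phi m = fun s =>
    vol [set y : 'rV[R]_m | parallel_body (embed [set 0]) eps (consrV (s, y))].
  apply/funext => s; rewrite vol_slice_parallel_body //; last exact: set1_body.
  by rewrite /phi /r; case: ifPn => // _; rewrite volr_parallel_point ?sqrtr_ge0.
have bP m : convex_body (parallel_body (embed [set (0 : 'rV[R]_m)]) eps).
  by apply: parallel_body_body; apply: embed_body; exact: set1_body.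
have mphi m : measurable_fun setT (phi m : measurableTypeR R -> _).
  by rewrite phiE; apply: measurable_vol_slice; exact: bP.
(* The integral is not computed: [phi m] is the slice volume of the parallel body of a single point,
   that is of a ball of dimension [m.+1]. *)
have iphi m : (\int[@lebesgue_measure R]_s phi m s =
    (ball_volume R m.+1 * eps ^+ m.+1)%:E)%E.
  rewrite phiE -vol_succ volrE //; congr (_%:E).
  have -> : embed [set (0 : 'rV[R]_m)] = [set 0].
    have c0 : consrV (0, 0) = 0 :> 'rV[R]_m.+1.
      apply/rowP => i; have [k ->|->] := unliftP ord0 i;
        by rewrite ?consrVS ?consrV0 !mxE.
    by apply/seteqP; split => z; [move=> [_ -> <-]|move=> ->; exists 0].
  exact: volr_parallel_point.
apply/eqP; rewrite -eqe -volrE; last exact: parallel_body_body.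
apply/eqP; rewrite vol_succ.
transitivity (\int[@lebesgue_measure R]_s
    \sum_(j < d.+1) ((intrinsic_volume j K)%:E * phi (d - j)%N s))%E.
  apply: eq_integral => s _; rewrite vol_slice_parallel_body // /phi.
  case: ifPn => se; last first.
    by rewrite big1 // => i _; rewrite mule0.
  rewrite (intrinsic_volume_spec bK).2 ?sqrtr_ge0 // -sumEFin.
  apply: eq_bigr => i _; rewrite -EFinM; congr (_%:E); rewrite /r; ring.
rewrite ge0_integral_sum //; last 2 first.
- by move=> i; apply: measurable_funeM; exact: mphi.
- by move=> i s _; rewrite mule_ge0 // lee_fin intrinsic_volume_ge0.
rewrite [in RHS]big_ord_recr /= ltnn mulr0 mul0r addr0 -sumEFin.
apply: eq_bigr => i _; have id : (i <= d)%N by rewrite -ltnS.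
rewrite ge0_integralZl //; last by rewrite lee_fin intrinsic_volume_ge0.
by rewrite iphi -EFinM id -subSn //; congr (_%:E); ring.
Qed.

Lemma lin_tailmx_embed (R : realType) (d : nat) (K : set 'rV[R]_d) :
  lin (tailmx R d) (embed K) = K.
Proof.
apply/seteqP; split => y; first by move=> [_ [k Kk <-] <-]; rewrite consrV_tail.
by move=> Ky; exists (consrV (0, y)); [exists y|rewrite consrV_tail].
Qed.

Lemma lin_tailmx_ball (R : realType) (d : nat) :
  lin (tailmx R d) (@unit_ball R d.+1) = @unit_ball R d.
Proof.
apply/seteqP; split => y.
  move=> [z z1 <-]; have [a [b zab]] := consrVP z.
  move: z1; rewrite zab consrV_tail /unit_ball /= => z1.
  apply: le_trans z1.
  rewrite -ler_sqr ?nnegrE ?enorm_ge0 // !sqr_enorm dot_consrV lerDr.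
  by rewrite -expr2 sqr_ge0.
move=> y1; exists (consrV (0, y)); last by rewrite consrV_tail.
by rewrite /unit_ball /= /enorm dot_consrV mul0r add0r.
Qed.

Lemma parallel_body_minksum (R : realType) (d : nat) (A B : set 'rV[R]_d) eps :
  parallel_body (minksum A B) eps = minksum (parallel_body A eps) B.
Proof. by rewrite !parallel_bodyE -!minksumA [minksum B _]minksumC. Qed.

(** Adding the segment adds its length times the parallel volume of K taken one dimension lower;
    against the Steiner formula of the cylinder this shifts the index by one. *)
Lemma intrinsic_volume_embed_cylinder (R : realType) (d : nat) (K : set 'rV[R]_d)
    (t : R) j : convex_body K -> 0 <= t -> (j <= d)%N ->
  intrinsic_volume j.+1 (minksum (embed K) (seg (consrV (t, 0)))) =
  intrinsic_volume j.+1 (embed K) + t *+ 2 * intrinsic_volume j (embed K).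
Proof.
move=> bK t0 jd; have bE := embed_body bK.
apply: (@intrinsic_volume_unique _ _ _ (fun j => intrinsic_volume j (embed K) +
  if j is j'.+1 then t *+ 2 * intrinsic_volume j' (embed K) else 0)) => //.
  exact: minksum_body bE (seg_body _).
move=> eps e0; rewrite parallel_body_minksum volr_minksum_seg_e0 //; last first.
  exact: parallel_body_body.
rewrite parallel_bodyE lin_minksum lin_tailmx_embed lin_scale lin_tailmx_ball.
rewrite -!parallel_bodyE (intrinsic_volume_spec bE).2 ?ltW //.
rewrite (intrinsic_volume_spec bK).2 ?ltW //.
under [RHS]eq_bigr do rewrite mulrDr mulrDl.
rewrite big_split /=; congr (_ + _).
rewrite [RHS]big_ord_recl /= mulr0 mul0r add0r mulr_sumr.
apply: eq_bigr => i _; rewrite /bump /= add1n subSS intrinsic_volume_embed //.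
  by ring.
by rewrite add0n -ltnS.
Qed.

Lemma minksum_translate (R : realType) (d : nat) c (A B : set 'rV[R]_d) :
  minksum [set c + x | x in A] B = [set c + x | x in minksum A B].
Proof.
apply/seteqP; split => z.
  move=> [_ [x Ax <-] [y By <-]]; exists (x + y); last by rewrite addrA.
  by exists x => //; exists y.
move=> [_ [x Ax [y By <-]] <-]; exists (c + x); first by exists x.
by exists y => //; rewrite addrA.
Qed.

(** A reflection sending u to the first axis, followed by a translation, carries C to an embedded
    body. *)
Lemma right_cylinder (R : realType) (d : nat) (C : set 'rV[R]_d.+1) u p t j :
  convex_body C -> enorm u = 1 -> (forall x, C x -> dot u x = p) -> 0 <= t ->
  (j <= d)%N ->
  intrinsic_volume j.+1 (minksum C (seg (t *: u))) =
  intrinsic_volume j.+1 C + t *+ 2 * intrinsic_volume j C.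
Proof.
move=> bC u1 Cu t0 jd.
have [|M [oM _ uM _]] := @exists_reflection _ _ u (consrV (1, 0)).
  by rewrite u1 enorm_consrV0.
pose K := lin (tailmx R d) (lin M C).
have bK : convex_body K by apply: lin_body; exact: lin_body.
have bE := embed_body bK.
have E : lin M C = [set consrV (p, 0) + x | x in embed K].
  have eE x : C x -> x *m M = consrV (p, 0) + consrV (0, x *m M *m tailmx R d).
    move=> Cx; have [a [b ab]] := consrVP (x *m M).
    rewrite ab consrV_tail consrVD addr0 add0r; congr (consrV (_, _)).
    by rewrite -(Cu x Cx) -(orthogonal_dot _ _ oM) uM ab dot_consrV mul1r
      dotC dot0r addr0.
  apply/seteqP; split => z.
    move=> [x Cx <-]; rewrite eE //; exists (consrV (0, x *m M *m tailmx R d)) => //.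
    by exists (x *m M *m tailmx R d) => //; exists (x *m M) => //; exists x.
  by move=> [_ [_ [_ [x Cx <-] <-] <-] <-]; rewrite -eE //; exists x.
have bS : convex_body (seg (consrV (t, 0 : 'rV[R]_d))) by exact: seg_body.
have VM k A : convex_body A -> intrinsic_volume k A = intrinsic_volume k (lin M A).
  by move=> bA; rewrite intrinsic_volume_orthogonal.
rewrite (VM j C bC) (VM j.+1 C bC) VM; last exact: minksum_body (seg_body _).
rewrite lin_minksum lin_seg -scalemxAl uM consrVZ mulr1 scaler0 E.
rewrite minksum_translate !intrinsic_volume_translate //; last exact: minksum_body.
exact: intrinsic_volume_embed_cylinder.
Qed.

(** The volume added by a segment is proportional to its length, for the parallel bodies as well,
    hence for each coefficient. *)
Lemma cylinder_affine (R : realType) (d : nat) (A : set 'rV[R]_d.+1) x a j :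
  convex_body A -> 0 <= a -> intrinsic_volume j (minksum A (seg (a *: x))) =
  intrinsic_volume j A +
  a * (intrinsic_volume j (minksum A (seg x)) - intrinsic_volume j A).
Proof.
move=> bA a0.
have bAa y : convex_body (minksum A (seg y)) by exact: minksum_body (seg_body _).
have [jd|jd] := leqP j d.+1; last first.
  by rewrite !(intrinsic_volume_spec _).1 // subrr mulr0 addr0.
have [M ME] := volr_minksum_seg x.
apply: (@intrinsic_volume_unique _ _ _ (fun j => intrinsic_volume j A +
  a * (intrinsic_volume j (minksum A (seg x)) - intrinsic_volume j A))) => //.
move=> eps e0; rewrite parallel_body_minksum ME //; last exact: parallel_body_body.
have h : volr (parallel_body (minksum A (seg x)) eps) =
    volr (parallel_body A eps) + (1 * enorm x) *+ 2 * volr (lin M (parallel_body A eps)).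
  by rewrite parallel_body_minksum -{1}(scale1r x) ME //; exact: parallel_body_body.
have -> : (a * enorm x) *+ 2 * volr (lin M (parallel_body A eps)) =
    a * (volr (parallel_body (minksum A (seg x)) eps) - volr (parallel_body A eps)).
  by rewrite h mul1r; ring.
rewrite !(intrinsic_volume_spec _).2 ?ltW // -sumrB mulr_sumr -big_split /=.
by apply: eq_bigr => i _; ring.
Qed.

(** The passage to the limit t -> 0, replaced by one explicit t: if a > b and c > 0, the value q
    below satisfies q c < a - b. *)
Lemma le_of_affine (R : realType) (a b c : R) :
  (forall t, 0 < t < 1 -> a <= b + t * c) -> a <= b.
Proof.
move=> h; rewrite leNgt; apply/negP => ba.
have [c0|c0] := lerP c 0; first by have := h (1 / 2) ltac:(lra); nra.
have D : 0 < a - b + 2 * c by lra.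
have [q qE] : exists q, q * (a - b + 2 * c) = a - b.
  by exists ((a - b) / (a - b + 2 * c)); rewrite divfK // gt_eqF.
have q0 : 0 < q by rewrite -(pmulr_lgt0 _ D) qE subr_gt0.
have q1 : q < 1 by rewrite -(ltr_pM2r D) qE; lra.
have := h q ltac:(by rewrite q0).
nra.
Qed.

(* Replacing x by its mirror image x' with respect to the line of u does not
   change the volume; and seg x + seg x' contains a segment along u. *)
Lemma oblique_cylinder (R : realType) (d : nat) (C : set 'rV[R]_d.+1) u p x j :
  convex_body C -> enorm u = 1 -> (forall y, C y -> dot u y = p) ->
  0 <= dot u x -> (j <= d)%N ->
  intrinsic_volume j.+1 C + dot u x *+ 2 * intrinsic_volume j C <=
  intrinsic_volume j.+1 (minksum C (seg x)).
Proof.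
move=> bC u1 Cu; set dl := dot u x => dl0 jd.
have uu : dot u u = 1 by rewrite -sqr_enorm u1 expr1n.
pose x' := (dl *+ 2) *: u - x.
have bS (A : set 'rV[R]_d.+1) y : convex_body A -> convex_body (minksum A (seg y)).
  by move=> bA; exact: minksum_body (seg_body _).
pose G a b := intrinsic_volume j.+1 (minksum (minksum C (seg (b *: x'))) (seg (a *: x))).
have Gsym : intrinsic_volume j.+1 (minksum C (seg x)) =
    intrinsic_volume j.+1 (minksum C (seg x')).
  (* The reflection in the hyperplane orthogonal to u only translates C, which lies at constant
     height, and it sends x to [- x'], which spans the same segment as x'. *)
  have [|M [oM _ uM fM]] := @exists_reflection _ _ u (- u); first by rewrite enormN.
  have zM z : z *m M = z - (dot u z *+ 2) *: u.
    have zE : z = dot u z *: u + (z - dot u z *: u) by rewrite addrC subrK.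
    have fz : (z - dot u z *: u) *m M = z - dot u z *: u.
      by apply: fM; rewrite !dotE uu (dotC z u); ring.
    rewrite {1}zE mulmxDl fz -scalemxAl uM.
    by apply/rowP => i; rewrite !mxE; ring.
  rewrite -(@intrinsic_volume_orthogonal _ _ M) //; last exact: bS.
  rewrite lin_minksum lin_seg.
  have -> : seg (x *m M) = seg x'.
    rewrite zM -/dl -[_ - _]opprB -/x'.
    by apply/seteqP; split => z [s s1 <-]; exists (- s); rewrite ?scaleNr ?scalerN ?opprK //;
      move: s1; rewrite /= !in_itv /=; lra.
  have -> : lin M C = [set - ((p *+ 2) *: u) + z | z in C].
    by apply/seteqP; split => z [y Cy <-]; exists y; rewrite // zM Cu // addrC.
  by rewrite minksum_translate intrinsic_volume_translate //; exact: bS.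
pose g := intrinsic_volume j.+1 (minksum C (seg x)) - intrinsic_volume j.+1 C.
pose G11 := intrinsic_volume j.+1 (minksum (minksum C (seg x')) (seg x)).
(* G is affine in each argument, hence quadratic on the diagonal; by [Gsym] both arguments
   contribute the same linear term g. *)
have GE a : 0 <= a -> G a a = intrinsic_volume j.+1 C + a * (g *+ 2) +
    a ^+ 2 * (G11 - intrinsic_volume j.+1 (minksum C (seg x)) *+ 2
              + intrinsic_volume j.+1 C).
  move=> a0; rewrite /G (cylinder_affine _ _ (bS _ _ bC)) //.
  rewrite [minksum (minksum C (seg (a *: x'))) (seg x)]minksumC minksumA.
  rewrite [minksum (seg x) C]minksumC (cylinder_affine _ _ (bS _ _ bC)) //.
  rewrite (cylinder_affine _ _ bC) // -Gsym /g /G11.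
  rewrite [minksum (minksum C (seg x')) (seg x)]minksumC minksumA [minksum (seg x) C]minksumC.
  by ring.
(* Since a x + a x' = 2 a dl u, the doubly oblique cylinder contains a right one. *)
have low a : 0 <= a -> intrinsic_volume j.+1 C +
    (a * (dl *+ 2)) *+ 2 * intrinsic_volume j C <= G a a.
  move=> a0; rewrite -(right_cylinder bC u1 Cu) ?mulr_ge0 ?mulrn_wge0 //.
  apply: le_intrinsic_volume; [exact: bS|exact/bS/bS|].
  move=> _ [y Cy [_ [s s1 <-] <-]].
  exists (y + s *: (a *: x')).
    by exists y => //; exists (s *: (a *: x')) => //; exists s.
  exists (s *: (a *: x)); first by exists s.
  rewrite -addrA; congr (_ + _); rewrite -scalerDr; congr (_ *: _).
  by rewrite -scalerDr subrK scalerA.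
have aux (t V0 V e k X : R) : 0 < t ->
    V0 + (t * (e *+ 2)) *+ 2 * V <= V0 + t * (k *+ 2) + t ^+ 2 * X ->
    e *+ 2 * V <= k + t * (X / 2).
  move=> t0 h; rewrite -(ler_pM2l t0).
  have E : V0 + t * (k *+ 2) + t ^+ 2 * X - (V0 + (t * (e *+ 2)) *+ 2 * V) =
      (t * (k + t * (X / 2)) - t * (e *+ 2 * V)) * 2 by field.
  by rewrite -subr_ge0 E pmulr_lge0 // subr_ge0 in h.
(* Both bounds on [G a a] agree at a = 0, so their first-order terms can be compared as a tends to
   0. *)
suff : dl *+ 2 * intrinsic_volume j C <= g by rewrite /g; lra.
apply: (@le_of_affine _ _ _ ((G11 - intrinsic_volume j.+1 (minksum C (seg x)) *+ 2
              + intrinsic_volume j.+1 C) / 2)) => t /andP[t0 t1].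
have := low t (ltW t0); rewrite (GE t (ltW t0)) => h.
exact: (aux _ _ _ _ _ _ t0 h).
Qed.

Definition cone (R : realType) (d : nat) (K : set 'rV[R]_d) (a : 'rV[R]_d) :
  set 'rV[R]_d :=
  [set z | exists t k, [/\ 0 <= t <= 1, K k & z = (1 - t) *: k + t *: a]].

Lemma cone_body (R : realType) (d : nat) (K : set 'rV[R]_d) a :
  convex_body K -> convex_body (cone K a).
Proof.
move=> [cK xK]; split.
  rewrite (_ : cone K a = (fun z : R * 'rV[R]_d => (1 - z.1) *: z.2 + z.1 *: a) @`
      (`[0, 1]%classic `*` K)).
    apply: continuous_compact; last first.
      by apply: compact_setX => //; exact: segment_compact.
    apply: continuous_subspaceT; apply: rV_continuous => i z.
    under eq_fun do rewrite !mxE.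
    apply: cvgD; apply: cvgM; last exact: cvg_cst.
    - by apply: cvgB; [exact: cvg_cst|exact: cvg_fst].
    - apply: (@continuous_comp _ _ _ snd (fun y : 'rV[R]_d => y 0 i)).
        exact: cvg_snd.
      exact: coord_rV_continuous.
    - exact: cvg_fst.
  apply/seteqP; split => z.
    by move=> [t [k [t01 Kk ->]]]; exists (t, k) => //; split; rewrite //= in_itv.
  by move=> [[t k] [/= t01 Kk] <-]; exists t, k; rewrite in_itv in t01.
move=> _ _ s [t [k [/andP[t0 t1] Kk ->]]] [t' [k' [/andP[t'0 t'1] Kk' ->]]] /andP[s0 s1].
pose T := (1 - s) * t + s * t'.
have T01 : 0 <= T <= 1 by rewrite /T; apply/andP; split; nra.
have w : 1 - T = (1 - s) * (1 - t) + s * (1 - t') by rewrite /T; ring.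
(* At the apex the base point has weight zero and is arbitrary; elsewhere the two base points are
   averaged with their renormalised weights. *)
have [T1|T1] := eqVneq T 1.
  exists T, k; split => //.
  have e1 : (1 - s) * (1 - t) = 0 by nra.
  have e2 : s * (1 - t') = 0 by nra.
  rewrite !scalerDr !scalerA e1 e2 !scale0r T1 subrr scale0r !add0r -scalerDl -/T.
  by rewrite T1.
have Tp : 0 < 1 - T by rewrite subr_gt0 lt_neqAle T1; case/andP: T01.
exists T, ((1 - s * (1 - t') / (1 - T)) *: k + (s * (1 - t') / (1 - T)) *: k'); split => //.
  apply: xK => //; apply/andP; split; first by rewrite divr_ge0 ?mulr_ge0 ?(ltW Tp) //; lra.
  by rewrite ler_pdivrMr // mul1r w lerDr mulr_ge0 //; lra.
have c1 : (1 - T) * (1 - s * (1 - t') / (1 - T)) = (1 - s) * (1 - t).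
  by rewrite mulrBr mulr1 mulrC divfK ?gt_eqF // w; ring.
have c2 : (1 - T) * (s * (1 - t') / (1 - T)) = s * (1 - t').
  by rewrite mulrC divfK ?gt_eqF.
rewrite [in RHS]scalerDr !scalerA c1 c2 !scalerDr !scalerA addrACA -scalerDl.
by rewrite -/T.
Qed.

Lemma bernoulli_le (R : realType) (t : R) n : 0 <= t <= 1 ->
  1 - n%:R * t <= (1 - t) ^+ n.
Proof.
move=> /andP[t0 t1]; elim: n => [|n ih]; first by rewrite mul0r subr0.
rewrite exprS mulrSr; have n0 : 0 <= n%:R :> R by [].
by have : 0 <= 1 - t by [lra]; nra.
Qed.

(* Cutting the cone at the fraction tau of its height leaves a copy of the cone
   scaled by 1 - tau above the cut, and an oblique cylinder over the cut below. *)
Lemma cone_volume_slice (R : realType) (d : nat) (K : set 'rV[R]_d.+1) u p h a tau j :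
  convex_body K -> enorm u = 1 -> K !=set0 -> (forall x, K x -> dot u x = p) ->
  0 < h -> dot u a = p + h -> 0 < tau < 1 -> (j <= d)%N ->
  tau * h * ((1 - tau) ^+ j * intrinsic_volume j K) <=
  (1 - (1 - tau) ^+ j.+1) * intrinsic_volume j.+1 (cone K a).
Proof.
move=> bK u1 [k0 Kk0] Ku h0 ua /andP[t0 t1] jd.
have bD := cone_body a bK; have [_ xK] := bK.
pose lam := 1 - tau; have lam0 : 0 < lam by rewrite /lam; lra.
pose q := p + tau * h.
have sec : section (cone K a) q u = [set tau *: a + x | x in [set lam *: k | k in K]].
  apply/seteqP; split => z.
    move=> [[t [k [t01 Kk ->]]]]; rewrite !dotE ua (Ku k Kk) /q => e.
    have tE : t = tau by apply: (mulIf (lt0r_neq0 h0)); lra.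
    by exists (lam *: k); [exists k|rewrite tE addrC].
  move=> [_ [k Kk <-] <-]; split.
    by exists tau, k; split => //; [lra|rewrite addrC].
  by rewrite !dotE ua (Ku k Kk) /q /lam; ring.
have bl (A : set 'rV[R]_d.+1) : convex_body A -> convex_body [set lam *: k | k in A].
  exact: scale_body.
have bt (A : set 'rV[R]_d.+1) c : convex_body A -> convex_body [set c + k | k in A].
  exact: translate_body.
have up : lam ^+ j.+1 * intrinsic_volume j.+1 (cone K a) <=
    intrinsic_volume j.+1 (upper_part (cone K a) q u).
  rewrite -intrinsic_volume_scale //.
  rewrite -(intrinsic_volume_translate (tau *: a)); last exact: bl.
  apply: le_intrinsic_volume; [exact/bt/bl|exact: upper_body|].
  move=> _ [_ [_ [t [k [/andP[t'0 t'1] Kk ->]]] <-] <-]; split.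
    exists (tau + lam * t), k; split => //; first by rewrite /lam; apply/andP; split; nra.
    rewrite scalerDr !scalerA addrCA -scalerDl; congr (_ *: _ + _).
    by rewrite /lam; ring.
  by rewrite !dotE ua (Ku k Kk) /q /lam; have : 0 <= (1 - tau) * (t * h); [rewrite !mulr_ge0 //; lra|lra].
(* C is the middle section of the cylinder: adding x to it gives the cut lam K + tau a, and
   subtracting x gives lam K + tau k0, which lies in K. *)
pose C := [set ((tau / 2) *: (k0 + a)) + x | x in [set lam *: k | k in K]].
have bC : convex_body C by exact/bt/bl.
pose x := (tau / 2) *: (a - k0).
have ux : dot u x = tau * h / 2 by rewrite !dotE ua (Ku k0 Kk0); field.
have low : intrinsic_volume j.+1 (minksum C (seg x)) <=
    intrinsic_volume j.+1 (lower_part (cone K a) q u).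
  apply: le_intrinsic_volume; [exact: minksum_body bC (seg_body _)|exact: lower_body|].
  move=> _ [_ [_ [k Kk <-] <-] [_ [r /= r1 <-] <-]].
  rewrite in_itv /= in r1; move: r1 => /andP[r0 r1].
  pose s := (1 + r) / 2; have s01 : 0 <= s <= 1 by rewrite /s; lra.
  have zE : tau / 2 *: (k0 + a) + lam *: k + r *: x =
      lam *: k + (tau * (1 - s)) *: k0 + (tau * s) *: a.
    by apply/rowP => i; rewrite !mxE /s; field.
  rewrite zE; split; last first.
    rewrite !dotE ua (Ku k0 Kk0) (Ku k Kk) /q /lam.
    have : tau * s * h <= tau * h by rewrite ler_pM2r // ler_piMr //; [lra|case/andP: s01].
    lra.
  have ts : 0 < 1 - tau * s by move: s01 => /andP[s0 s1]; nra.
  exists (tau * s), ((1 - (tau * (1 - s)) / (1 - tau * s)) *: k +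
    (tau * (1 - s) / (1 - tau * s)) *: k0); split.
  - by move: s01 => /andP[s0 s1]; apply/andP; split; nra.
  - apply: xK => //; move: s01 => /andP[s0 s1]; apply/andP; split.
      by rewrite divr_ge0 ?mulr_ge0 ?(ltW ts) //; lra.
    by rewrite ler_pdivrMr // mul1r; lra.
  - apply/rowP => i; rewrite !mxE /lam; field.
    by rewrite gt_eqF.
have obl := @oblique_cylinder _ _ C u (lam * p + tau / 2 * (p + (p + h))) x j bC u1.
have {}obl := obl ltac:(move=> _ [_ [k Kk <-] <-];
  rewrite !dotE ua (Ku k0 Kk0) (Ku k Kk); ring).
have {}obl := obl ltac:(rewrite ux; apply: divr_ge0 => //; apply: mulr_ge0; lra) jd.
have CE i : (i <= d.+1)%N -> intrinsic_volume i C = lam ^+ i * intrinsic_volume i K.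
  by move=> id; rewrite intrinsic_volume_translate ?intrinsic_volume_scale //; exact: bl.
have SE : intrinsic_volume j.+1 (section (cone K a) q u) =
    lam ^+ j.+1 * intrinsic_volume j.+1 K.
  by rewrite sec intrinsic_volume_translate ?intrinsic_volume_scale //; exact: bl.
(* The [j.+1]-th volume of the cut equals that of C, so it cancels against the first term of the
   oblique cylinder bound. *)
have md := intrinsic_volume_modular q u j.+1 bD.
rewrite !CE ?(leqW jd) // ux in obl.
rewrite SE in md.
have -> : tau * h * ((1 - tau) ^+ j * intrinsic_volume j K) =
  (tau * h / 2) *+ 2 * (lam ^+ j * intrinsic_volume j K).
  by rewrite /lam; field.
rewrite mulrBl mul1r -/lam; lra.
Qed.

(** The limit tau -> 0 of [cone_volume_slice] divided by tau; the factor [j.+1] is the slope at 0 of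
    1 - (1 - tau)^(j+1). Bernoulli's inequality makes both sides affine in tau, as [le_of_affine]
    requires. *)
Lemma cone_volume (R : realType) (d : nat) (S : set 'rV[R]_d.+1) u p h a j :
  convex_body S -> enorm u = 1 -> 0 < h -> dot u a = p + h -> S a -> (j <= d)%N ->
  h * intrinsic_volume j (section S p u) <= j.+1%:R * intrinsic_volume j.+1 S.
Proof.
move=> bS u1 h0 ua Sa jd; have bK := section_body p u bS.
have VS0 : 0 <= intrinsic_volume j.+1 S by exact: intrinsic_volume_ge0.
have [K0|/set0P K0] := eqVneq (section S p u) set0.
  by rewrite K0 intrinsic_volume_set0 mulr0 mulr_ge0.
have Ku x : section S p u x -> dot u x = p by case.
have VK0 : 0 <= intrinsic_volume j (section S p u) by exact: intrinsic_volume_ge0.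
have le : intrinsic_volume j.+1 (cone (section S p u) a) <= intrinsic_volume j.+1 S.
  apply: le_intrinsic_volume => //; first exact: cone_body.
  by move=> _ [t [k [t01 [Sk _] ->]]]; have [_ xS] := bS; exact: xS.
apply: le_trans (_ : j.+1%:R * intrinsic_volume j.+1 (cone (section S p u) a) <= _);
  last by rewrite ler_wpM2l.
set V := intrinsic_volume j.+1 _.
have V0 : 0 <= V by apply: intrinsic_volume_ge0; exact: cone_body.
apply: (@le_of_affine _ _ _ (h * (j%:R * intrinsic_volume j (section S p u)))) => t /andP[t0 t1].
have := cone_volume_slice bK u1 K0 Ku h0 ua (_ : 0 < t < 1) jd.
rewrite -/V t0 t1 => /(_ isT) sl.
have t01 : 0 <= t <= 1 by rewrite !ltW.
have b1 := bernoulli_le j t01; have b2 := bernoulli_le j.+1 t01.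
set W := intrinsic_volume j (section S p u) in sl VK0 *.
have s1 : (1 - (1 - t) ^+ j.+1) * V <= (j.+1%:R * t) * V by rewrite ler_wpM2r //; lra.
have s2 : t * h * ((1 - j%:R * t) * W) <= t * h * ((1 - t) ^+ j * W).
  by rewrite ler_wpM2l ?mulr_ge0 ?ler_wpM2r // ltW.
rewrite -(ler_pM2l t0); lra.
Qed.

(** * The search algorithm *)

(** Nonempty interior, with an explicit Euclidean ball so that monotonicity bounds every intrinsic
    volume from below by a positive one. *)
Definition fat (R : realType) (d : nat) (S : set 'rV[R]_d) : Prop :=
  exists c r, 0 < r /\ forall b, unit_ball b -> S (c + r *: b).

Lemma fat_cube (R : realType) (d : nat) : fat (@unit_cube R d).
Proof.
exists (const_mx (1 / 2)), (1 / 2); split => // b b1 i; rewrite !mxE.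
have := le_trans (coord_le_enorm b i) b1; rewrite ler_norml; lra.
Qed.

Lemma fat_intrinsic_volume_gt0 (R : realType) (d : nat) (S : set 'rV[R]_d) j :
  convex_body S -> fat S -> (j <= d)%N -> 0 < intrinsic_volume j S.
Proof.
move=> bS [c [r [r0 Sr]]] jd; have bB := @unit_ball_body R d.
apply: (@lt_le_trans _ _ (intrinsic_volume j
    [set c + x | x in [set r *: x | x in @unit_ball R d]])).
  rewrite intrinsic_volume_translate; last exact: scale_body.
  rewrite intrinsic_volume_scale // mulr_gt0 ?exprn_gt0 //.
  exact: intrinsic_volume_ball_gt0.
apply: le_intrinsic_volume => //; first exact/translate_body/scale_body.
by move=> _ [_ [b Bb <-] <-]; exact: Sr.
Qed.

(** The ball is shrunk towards x by the ratio tau. It stays in S by convexity; A bounds how far it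
    reaches below x in direction u, and tau is small enough to keep the copy above the cut. *)
Lemma fat_upper_part (R : realType) (d : nat) (S : set 'rV[R]_d) p u x :
  convex_body S -> fat S -> S x -> p < dot u x -> fat (upper_part S p u).
Proof.
move=> [_ xS] [c [r [r0 Sr]]] Sx px.
pose A := `|dot u c - dot u x| + r * enorm u.
have A0 : 0 <= A by rewrite addr_ge0 // mulr_ge0 ?enorm_ge0 // ltW.
have D0 : 0 < dot u x - p + A by rewrite ltr_wpDr // subr_gt0.
pose tau := (dot u x - p) / (dot u x - p + A).
have tE : tau * (dot u x - p + A) = dot u x - p by rewrite divfK // gt_eqF.
have t0 : 0 < tau by rewrite divr_gt0 // subr_gt0.
have t1 : tau <= 1 by rewrite ler_pdivrMr // mul1r lerDl.
exists ((1 - tau) *: x + tau *: c), (tau * r); split; first exact: mulr_gt0.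
move=> b b1; have -> : (1 - tau) *: x + tau *: c + (tau * r) *: b =
    (1 - tau) *: x + tau *: (c + r *: b) by rewrite scalerDr scalerA addrA.
split; first by apply: xS => //; [exact: Sr|rewrite (ltW t0)].
have h : - A <= dot u c - dot u x + r * dot u b.
  have h1 := ler_norm (- (dot u c - dot u x)); rewrite normrN in h1.
  have h2 := dot_le_enorm (- u) b; rewrite enormN dotNl in h2.
  have h3 : enorm u * enorm b <= enorm u by rewrite ler_piMr ?enorm_ge0.
  have : r * - dot u b <= r * enorm u by rewrite ler_pM2l //; lra.
  rewrite /A; lra.
rewrite !dotE.
have : tau * - A <= tau * (dot u c - dot u x + r * dot u b) by rewrite ler_pM2l.
have : 0 <= tau * (dot u x - p) by rewrite mulr_ge0 ?(ltW t0) // subr_ge0 ltW.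
lra.
Qed.

Lemma lower_partN (R : realType) (d : nat) (S : set 'rV[R]_d) p u :
  lower_part S p u = upper_part S (- p) (- u).
Proof. by apply/seteqP; split => x [Sx px]; split => //; rewrite dotNl lerN2 in px *. Qed.

Lemma sectionN (R : realType) (d : nat) (S : set 'rV[R]_d) p u :
  section S p u = section S (- p) (- u).
Proof.
apply/seteqP; split => x [Sx px]; split => //; first by rewrite dotNl px.
by apply: oppr_inj; rewrite -dotNl.
Qed.

Lemma half_widthE (R : realType) (d : nat) (S : set 'rV[R]_d) u :
  convex_body S -> S !=set0 ->
  exists x y, [/\ S x, S y, forall z, S z -> dot u y <= dot u z <= dot u x &
    half_width S u = (dot u x - dot u y) / 2].
Proof.
move=> [cS _] S0.
have cu : {within S, continuous (dot u)} by exact/continuous_subspaceT/dot_continuous.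
have [x /[!inE] Sx xM] := compact_EVT_max S0 cS cu.
have [y /[!inE] Sy ym] := compact_EVT_min S0 cS cu.
have Sb z : S z -> dot u y <= dot u z <= dot u x.
  by move=> Sz; rewrite ym ?xM // inE.
exists x, y; split => //; rewrite /half_width; congr ((_ - _) / 2).
  apply/eqP; rewrite eq_le; apply/andP; split.
    apply: ge_sup; first by exists (dot u x); exists x.
    by move=> _ [z Sz <-]; case/andP: (Sb z Sz).
  apply: ub_le_sup; last by exists x.
  by exists (dot u x) => _ [z Sz <-]; case/andP: (Sb z Sz).
apply/eqP; rewrite eq_le; apply/andP; split.
  apply: ge_inf; last by exists y.
  by exists (dot u y) => _ [z Sz <-]; case/andP: (Sb z Sz).
apply: lb_le_inf; first by exists (dot u y); exists y.
by move=> _ [z Sz <-]; case/andP: (Sb z Sz).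
Qed.

(** The segment from y to x is an oblique cylinder over its midpoint, and V_0 of a point is 1. *)
Lemma width_le_intrinsic_volume1 (R : realType) (d : nat) (S : set 'rV[R]_d.+1) u x y :
  convex_body S -> enorm u = 1 -> S x -> S y ->
  dot u x - dot u y <= intrinsic_volume 1 S.
Proof.
move=> bS u1 Sx Sy.
have [xy|xy] := lerP (dot u x) (dot u y).
  by rewrite (le_trans _ (intrinsic_volume_ge0 _ bS)) // subr_le0.
pose m := (1 / 2) *: (x + y); pose z := (1 / 2) *: (x - y).
have uz : dot u z = (dot u x - dot u y) / 2 by rewrite !dotE; field.
have := @oblique_cylinder _ _ [set m] u (dot u m) z 0 (set1_body m) u1.
rewrite !intrinsic_volume_set1 /= add0r mulr1 uz => h.
apply: le_trans (_ : intrinsic_volume 1 (minksum [set m] (seg z)) <= _).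
  apply: le_trans (h _ _ isT); [by rewrite -mulr_natr; lra|by move=> _ ->|lra].
apply: le_intrinsic_volume => //.
  exact: minksum_body (set1_body _) (seg_body _).
move=> _ [_ -> [_ [s /= s1 <-] <-]]; rewrite in_itv /= in s1.
have -> : m + s *: z = (1 - (1 + s) / 2) *: y + ((1 + s) / 2) *: x.
  by apply/rowP => i; rewrite !mxE; field.
by have [_ xS] := bS; apply: xS => //; lra.
Qed.

Lemma c_gt0 (R : realType) i : 0 < c_ R i.
Proof. by rewrite /c_ invr_gt0 mulr_gt0 ?exprn_gt0 // ltr0n fact_gt0. Qed.

(** The relation behind the choice of the constants. It starts at index 1, since [c_ R 0] and
    [c_ R 1] are both 1. *)
Lemma c_succ (R : realType) i : c_ R i.+1 = c_ R i.+2 * (i.+2%:R * 2).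
Proof.
rewrite /c_ /= exprS (factS i.+1) natrM; field.
apply/and3P; split; apply: lt0r_neq0; last exact: exprn_gt0.
  by rewrite ltr0n fact_gt0.
by rewrite ltr_wpDr.
Qed.

Lemma powR_invK (R : realType) (x : R) i : 0 <= x -> (0 < i)%N ->
  (x `^ i%:R^-1) ^+ i = x.
Proof.
move=> x0 i0; rewrite -powR_mulrn ?powR_ge0 // -powRrM mulVf ?powRr1 //.
by rewrite pnatr_eq0 -lt0n.
Qed.

Lemma intrinsic_volume_ge_width (R : realType) (d : nat) (S : set 'rV[R]_d.+1) u q j :
  convex_body S -> S !=set0 -> enorm u = 1 -> 0 < half_width S u -> (j <= d)%N ->
  ((half_width S u)%:E <= L_ S u q j)%E ->
  2 * c_ R j.+1 * half_width S u ^+ j.+1 <= intrinsic_volume j.+1 S.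
Proof.
move=> bS S0 u1 w0 jd Lj.
have [x [y [Sx Sy Sxy wE]]] := half_widthE u bS S0.
set w := half_width S u in w0 wE Lj *.
(* For index 0 the hypothesis on L is vacuous; as c_1 = 1, the claim is that V_1 is at least the
   full width. *)
case: j jd Lj => [|j] jd Lj.
  have -> : c_ R 1 = 1 by rewrite /c_ expr0 mul1r (_ : 1`! = 1%N) // invr1.
  rewrite expr1 mulr1.
  apply: le_trans (width_le_intrinsic_volume1 bS u1 Sx Sy).
  by rewrite wE; lra.
set K := section S (q j.+1) u.
have VK0 : 0 <= intrinsic_volume j.+1 K by apply: intrinsic_volume_ge0; exact: section_body.
have VK : c_ R j.+1 * w ^+ j.+1 <= intrinsic_volume j.+1 K.
  rewrite mulrC -ler_pdivlMr ?c_gt0 //.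
  rewrite -[leRHS](@powR_invK _ _ j.+1) //; last by rewrite divr_ge0 // ltW // c_gt0.
  rewrite lerXn2r // ?nnegrE ?powR_ge0 ?(ltW w0) //.
have [h hw hV] : exists2 h, w <= h &
    h * intrinsic_volume j.+1 K <= j.+2%:R * intrinsic_volume j.+2 S.
  (* The extreme points are 2 w apart in direction u, so one of them is at least w away from the
     cut. For the lower one, u and the cut change sign. *)
  have [wx|wx] := lerP w (dot u x - q j.+1).
    exists (dot u x - q j.+1) => //; apply: (cone_volume bS u1 _ _ Sx jd); first lra.
    by rewrite addrC subrK.
  exists (q j.+1 - dot u y); first lra.
  rewrite /K sectionN; apply: (cone_volume bS _ _ _ Sy jd); first by rewrite enormN.
    lra.
  by rewrite dotNl; ring.
have c0 := c_gt0 R j.+2.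
have h1 : w * (c_ R j.+1 * w ^+ j.+1) <= j.+2%:R * intrinsic_volume j.+2 S.
  apply: le_trans hV; apply: ler_pM; [exact: ltW| |exact: hw|exact: VK].
  by apply: mulr_ge0; [exact/ltW/c_gt0|exact/exprn_ge0/ltW].
rewrite c_succ in h1.
have j0 : 0 < j.+2%:R :> R by [].
rewrite -(ler_pM2l j0); apply: le_trans h1.
rewrite le_eqVlt; apply/orP; left; apply/eqP.
by rewrite [w ^+ j.+2]exprS; ring.
Qed.

Lemma section_le_width (R : realType) (d : nat) (S : set 'rV[R]_d) u q j :
  convex_body S -> 0 <= half_width S u -> (0 < j)%N ->
  (L_ S u q j <= (half_width S u)%:E)%E ->
  intrinsic_volume j (section S (q j) u) <= c_ R j * half_width S u ^+ j.
Proof.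
case: j => // j bS w0 _; rewrite /L_ lee_fin => Lj.
have VK0 : 0 <= intrinsic_volume j.+1 (section S (q j.+1) u).
  by apply: intrinsic_volume_ge0; exact: section_body.
rewrite mulrC -ler_pdivrMr ?c_gt0 //.
rewrite -[leLHS](@powR_invK _ _ j.+1) //; last by rewrite divr_ge0 // ltW // c_gt0.
by rewrite lerXn2r // ?nnegrE ?powR_ge0.
Qed.

Lemma guess_progress (R : realType) (d : nat) (S : set 'rV[R]_d.+1) u p :
  convex_body S -> fat S -> enorm u = 1 -> symmetric_search_guess S u p ->
  0 < half_width S u /\
  exists j, [/\ (j <= d)%N,
    2 * c_ R j.+1 * half_width S u ^+ j.+1 <= intrinsic_volume j.+1 S,
    forall S', S' = upper_part S p u \/ S' = lower_part S p u ->
      fat S' /\ intrinsic_volume j.+1 S' <= 3 / 4 * intrinsic_volume j.+1 S &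
    forall v, S v -> `|dot u v - p| <= 2 * half_width S u].
Proof.
move=> bS fS u1 [q [[|j] [bal //= jd Lw wL ->]]].
have [c [r [r0 Sr]]] := fS.
have S0 : S !=set0 by exists (c + r *: 0); apply: Sr; rewrite /unit_ball /= enorm0.
have [x [y [Sx Sy Sxy wE]]] := half_widthE u bS S0.
have uu : dot u u = 1 by rewrite -sqr_enorm u1 expr1n.
have w0 : 0 < half_width S u.
  have /Sxy/andP[_ h1] : S (c + r *: u) by apply: Sr; rewrite /unit_ball /= u1.
  have /Sxy/andP[h2 _] : S (c + r *: - u) by apply: Sr; rewrite /unit_ball /= enormN u1.
  rewrite !dotE uu in h1 h2; rewrite wE; lra.
split => //; exists j.
have V0 : 0 < intrinsic_volume j.+1 S by exact: fat_intrinsic_volume_gt0.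
have Vw := intrinsic_volume_ge_width bS S0 u1 w0 jd Lw.
have Kw := section_le_width bS (ltW w0) (ltn0Sn j) wL.
have md := intrinsic_volume_modular (q j.+1) u j.+1 bS.
have bl := bal j.+1 jd.
(* By balance and modularity each side is half of V(S) + V(K), and V(K) <= c w^(j+1) <= V(S) / 2. *)
have V34 S' : S' = upper_part S (q j.+1) u \/ S' = lower_part S (q j.+1) u ->
    intrinsic_volume j.+1 S' <= 3 / 4 * intrinsic_volume j.+1 S.
  by move=> [] ->; lra.
have px : q j.+1 < dot u x.
  rewrite ltNge; apply/negP => xp.
  have : lower_part S (q j.+1) u = S.
    apply/seteqP; split => z; first by case.
    by move=> Sz; split => //; have /andP[_ h] := Sxy z Sz; exact: le_trans xp.
  by move=> E; have := V34 _ (or_intror erefl); rewrite E; lra.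
have yp : dot u y < q j.+1.
  rewrite ltNge; apply/negP => yp.
  have : upper_part S (q j.+1) u = S.
    apply/seteqP; split => z; first by case.
    by move=> Sz; split => //; have /andP[h _] := Sxy z Sz; exact: le_trans h.
  by move=> E; have := V34 _ (or_introl erefl); rewrite E; lra.
split => //.
- move=> S' S'E; split; last exact: V34.
  case: S'E => ->; first exact: fat_upper_part Sx px.
  by rewrite lower_partN; apply: (fat_upper_part bS fS Sy); rewrite dotNl ltrN2.
- by move=> v /Sxy/andP[? ?]; rewrite ler_norml wE; lra.
Qed.

(** * The potential function *)

(** Chosen so that a term whose V_j shrinks to 3/4 or less drops by at least (2 w)^beta as soon as
    V_j >= 2 c_j w^j. *)
Definition weight (R : realType) (beta : R) (j : nat) : R :=
  2 `^ beta / ((1 - (3 / 4) `^ (beta / j%:R)) * (2 * c_ R j) `^ (beta / j%:R)).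

Definition potential (R : realType) (beta : R) (d : nat) (S : set 'rV[R]_d) : R :=
  \sum_(j < d) weight beta j.+1 * intrinsic_volume j.+1 S `^ (beta / j.+1%:R).

Lemma powR34_lt1 (R : realType) (g : R) : 0 < g -> (3 / 4 : R) `^ g < 1.
Proof.
move=> g0; have : (3 / 4 : R) `^ g < 1 `^ g.
  by apply: gt0_ltr_powR => //; rewrite ?nnegrE; lra.
by rewrite powR1.
Qed.

Lemma weight_gt0 (R : realType) (beta : R) j : 0 < beta -> 0 < weight beta j.+1.
Proof.
move=> b0; have g0 : 0 < beta / j.+1%:R by rewrite divr_gt0.
rewrite divr_gt0 ?powR_gt0 // mulr_gt0 ?subr_gt0 ?powR34_lt1 // powR_gt0 //.
by rewrite mulr_gt0 // c_gt0.
Qed.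

Lemma potential_ge0 (R : realType) (beta : R) (d : nat) (S : set 'rV[R]_d) :
  0 < beta -> 0 <= potential beta S.
Proof.
by move=> b0; apply: sumr_ge0 => j _; rewrite mulr_ge0 ?powR_ge0 // ltW // weight_gt0.
Qed.

Lemma ler_sum_drop (R : realType) (n : nat) (F G : 'I_n -> R) l i :
  l + G i <= F i -> (forall k, G k <= F k) -> l + \sum_k G k <= \sum_k F k.
Proof.
move=> li GF; rewrite (bigD1 i) // (bigD1 (P := predT) (F := F) i) //= addrA.
by rewrite lerD // ler_sum.
Qed.

(** The term of index [j.+1] pays for the loss l; the others do not increase, by monotonicity of
    intrinsic volumes. *)
Lemma potential_drop (R : realType) (beta : R) (d : nat) (S S' : set 'rV[R]_d.+1)
    j (w l : R) : 0 < beta -> convex_body S -> convex_body S' -> S' `<=` S ->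
  (j <= d)%N -> 0 < w -> 2 * c_ R j.+1 * w ^+ j.+1 <= intrinsic_volume j.+1 S ->
  intrinsic_volume j.+1 S' <= 3 / 4 * intrinsic_volume j.+1 S ->
  0 <= l <= 2 * w -> l `^ beta + potential beta S' <= potential beta S.
Proof.
move=> b0 bS bS' SS' jd w0 Vw V34 /andP[l0 lw].
have jd' : (j < d.+1)%N by [].
apply: (ler_sum_drop (i := Ordinal jd')) => [|i]; last first.
  have g0 : 0 < beta / i.+1%:R by rewrite divr_gt0.
  apply: ler_wpM2l; first exact/ltW/weight_gt0.
  apply: ge0_ler_powR; rewrite ?nnegrE ?intrinsic_volume_ge0 ?(ltW g0) //.
  exact: le_intrinsic_volume.
rewrite [val _]/=.
set g := beta / j.+1%:R; have g0 : 0 < g by rewrite divr_gt0.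
set V := intrinsic_volume j.+1 S; set V' := intrinsic_volume j.+1 S'.
have V'0 : 0 <= V' by exact: intrinsic_volume_ge0.
have V0 : 0 <= V by exact: intrinsic_volume_ge0.
have W0 := weight_gt0 j b0.
have c0 := c_gt0 R j.+1.
have h1 : V' `^ g <= (3 / 4) `^ g * V `^ g.
  rewrite -powRM //.
  by apply: ge0_ler_powR; rewrite ?nnegrE ?(ltW g0) // mulr_ge0 //; lra.
have h2 : (2 * c_ R j.+1) `^ g * w `^ beta <= V `^ g.
  have -> : w `^ beta = (w ^+ j.+1) `^ g.
    by rewrite -powR_mulrn ?(ltW w0) // -powRrM /g mulrC divfK // pnatr_eq0.
  rewrite -powRM; [|by rewrite mulr_ge0 // ltW|by rewrite exprn_ge0 // ltW].
  apply: ge0_ler_powR; rewrite ?nnegrE ?(ltW g0) //.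
  by rewrite mulr_ge0 ?exprn_ge0 ?(ltW w0) // mulr_ge0 // ltW.
have h3 : l `^ beta <= 2 `^ beta * w `^ beta.
  rewrite -powRM ?(ltW w0) //.
  by apply: ge0_ler_powR; rewrite ?nnegrE ?(ltW b0) // mulr_ge0 // ltW.
have q1 := powR34_lt1 g0.
have cg0 : 0 < (2 * c_ R j.+1) `^ g by rewrite powR_gt0 // mulr_gt0.
have WE : 2 `^ beta * w `^ beta = weight beta j.+1 *
    ((1 - (3 / 4) `^ g) * ((2 * c_ R j.+1) `^ g * w `^ beta)).
  by rewrite /weight -/g; field; rewrite !gt_eqF // subr_gt0.
rewrite -lerBrDr; apply: le_trans h3 _; rewrite WE -mulrBr ler_pM2l //.
have : (1 - (3 / 4) `^ g) * ((2 * c_ R j.+1) `^ g * w `^ beta) <=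
    (1 - (3 / 4) `^ g) * V `^ g by rewrite ler_wpM2l // subr_ge0 ltW.
by move/le_trans; apply; rewrite mulrBl mul1r lerD2l lerN2.
Qed.

Theorem theorem39 (R : realType) (d : nat) (beta : R) (beta_gt0 : 0 < beta) :
  exists C : R, forall (T : nat) (v : 'rV[R]_d) (u : nat -> 'rV[R]_d)
      (p : nat -> R),
    unit_cube v ->
    (forall t, (t < T)%N -> enorm (u t) = 1) ->
    symmetric_search T u v p ->
    \sum_(t < T) loss beta (dot (u t) v) (p t) <= C.
Proof.
case: d => [|d].
  (* There is no unit vector in dimension 0, so T = 0. *)
  exists 0 => T v u p _ u1 _; case: T u1 => [|T] u1; first by rewrite big_ord0.
  have := u1 0%N isT; rewrite /enorm /dot big_ord0 sqrtr0 => /eqP.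
  by rewrite eq_sym oner_eq0.
exists (potential beta (@unit_cube R d.+1)) => T v u p v01 u1 search.
(* The losses so far plus the current potential never exceed the potential of the cube, which
   depends on the dimension and beta only. *)
have inv t : (t <= T)%N -> [/\ convex_body (knowledge u p v t),
    fat (knowledge u p v t), knowledge u p v t v &
    \sum_(i < t) loss beta (dot (u i) v) (p i) + potential beta (knowledge u p v t) <=
    potential beta (@unit_cube R d.+1)].
  elim: t => [|t ih] tT.
    rewrite big_ord0 add0r; split => //; [exact: unit_cube_body|exact: fat_cube].
  have [bS fS Sv sum] := ih (ltnW tT).
  set S := knowledge u p v t in bS fS Sv sum.
  have [w0 [j [jd Vw S'P Sl]]] := guess_progress bS fS (u1 t tT) (search t tT).
  have S'E : knowledge u p v t.+1 = upper_part S (p t) (u t) \/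
      knowledge u p v t.+1 = lower_part S (p t) (u t).
    by rewrite /=; case: ifP => _; [left|right].
  have [fS' V34] := S'P _ S'E.
  have bS' : convex_body (knowledge u p v t.+1).
    by case: S'E => ->; [exact: upper_body|exact: lower_body].
  have SS' : knowledge u p v t.+1 `<=` S by case: S'E => -> x [].
  split; [exact: bS'|exact: fS'| |].
    by rewrite /=; case: ifPn => // h; split => //; rewrite ltW // ltNge.
  rewrite big_ord_recr /= -addrA; apply: le_trans sum; rewrite lerD2l.
  by apply: (potential_drop beta_gt0 bS bS' SS' jd w0 Vw V34); rewrite normr_ge0 Sl.
have [_ _ _ h] := inv T (leqnn T); apply: le_trans h.
by rewrite lerDl potential_ge0.
Qed.
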